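(* Let $D,\Delta$ be constants and let $\varepsilon_*=\frac1{2\Delta-1}$. Let $\varepsilon_{**}=O(\min\{1/D,(D/\Delta)^{\Delta/2}\})$, $\varepsilon_{**}<\varepsilon_*$, be a threshold depending only on $D,\Delta$ below which PEPS satisfy decay of loops (with rate $c>c_0$). Consider a PEPS with bond dimension $D$ on a finite graph $G=(V,E)$ of maximum degree $\Delta$, with injectivity parameter $\varepsilon<\varepsilon_{**}$, and perturb it in a local region $A\subset V$, $T_A\to T_A'$ (all tensors outside $A$ unchanged), such that $\|T_A-T_A'\|_\infty=O(\varepsilon_*-\varepsilon)$ (that is, at most a sufficiently small constant times $\varepsilon_*-\varepsilon$). Let $\boldsymbol\mu_\star$ and $\boldsymbol\mu_\star'$ be the BP fixed points of the original and perturbed PEPS. Then for any directed edge $\vec e=(v,n)$ with $d(v,A)=r$, $$\|\mu'_{\star,\vec e}-\mu_{\star,\vec e}\|_1=O(e^{-r/\xi_*}),\qquad 1/\xi_*=O(\log(\varepsilon_*/\varepsilon)).$$ Further, for any observable $O_B$ with $\|O_B\|_\infty=1$ supported in a local region $B$ at graph distance $R$ from $A$, $$\left|\langle O_B\rangle'-\langle O_B\rangle\right|=O(e^{-R/\xi_{**}}),\qquad 1/\xi_{**}=O(\min\{1/\xi_*,\,c-c_0\}),$$ where $\langle O_B\rangle$ and $\langle O_B\rangle'$ are the expectation values of $O_B$ in the original and the perturbed PEPS, respectively.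
   Context: PEPS. $\mathcal N(v)$ denotes the neighbors of $v$. A PEPS assigns to each $v$ a linear map $T_v:\bigotimes_{n\in\mathcal N(v)}\mathcal H_{(n,v)}\to\mathcal H_v$ with $\mathcal H_{(n,v)}\cong\mathbb C^D$; the state $|\psi\rangle$ is obtained by contracting, for every edge $\{v,w\}$, the leg of $T_v$ belonging to $w$ with the leg of $T_w$ belonging to $v$. $\langle O\rangle=\langle\psi|O|\psi\rangle/\langle\psi|\psi\rangle$. Each $T_v$ is normalized to have largest singular value $1$ (rescaling a tensor does not affect messages or expectation values; the injectivity parameter of a perturbed tensor is computed from the ratio of smallest to largest singular value); the PEPS has injectivity parameter $\varepsilon=1-\delta^2$ if all singular values of all $T_v$ lie in $[\delta,1]$. $\|T_A-T_A'\|_\infty$ is the operator norm of the change of the tensors in $A$, viewed as maps from virtual to physical spaces. A region is local if it has $O(1)$ vertices; $d$ is graph distance. BP fixed point. $\mathcal K_G$ is the set of families $\boldsymbol\mu=(\mu_{\vec e})$ of positive semidefinite trace-one operators on $\mathbb C^D$, one per directed edge. Let $E_v(\bigotimes_nX_n)=\mathrm{Tr}[T_v(\bigotimes_nX_n)T_v^\dagger]$ and $b(X,Y)=\sum_{ij}X_{ij}Y_{ij}$ (contraction of a double-layer bond). $\Phi_{(v,n)}(X)$ is defined by $b(\Phi_{(v,n)}(X),Y)=E_v(X\otimes Y)$, $Y$ on leg $n$ and $X$ on the other legs. $\boldsymbol\mu$ is a BP fixed point if $\mu_{(v,n)}=\Phi_{(v,n)}(\bigotimes_{m\in\mathcal N(v)\setminus\{n\}}\mu_{(m,v)})/\mathrm{Tr}[\cdot]$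 for every directed edge. For injectivity parameter below $\varepsilon_*$ it exists and is unique. Decay of loops. For $e=\{v,w\}$ let $I_e=b(\mu_{\star,(v,w)},\mu_{\star,(w,v)})$, $P_e(Y)=\frac{b(\mu_{\star,(w,v)},Y)}{I_e}\mu_{\star,(v,w)}$ (orientation $v\to w$), $P_e^\perp=\mathrm{id}-P_e$. A loop $\ell=(W,F)$ is a connected subgraph with all degrees at least $2$, $|\ell|=|F|$. $Z_\ell$ is the contraction of the norm network $\langle\psi|\psi\rangle$ with $P_e^\perp$ inserted on edges in $F$ and $P_e$ on the others, divided by the contraction with $P_e$ on all edges. Decay of loops with rate $c$ means $|Z_\ell|\le e^{-c|\ell|}$ for all loops, for some $c>c_0:=\log(2e\Delta)+\frac12$. The implied constants in the conclusions may depend on $D,\Delta,\varepsilon,|A|,|B|$ but not on the size of the graph, $r$ or $R$. *)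

(* Defs.v *)
From HB Require Import structures.
From mathcomp Require Import all_boot all_order all_algebra.
From mathcomp Require Import sesquilinear spectral.
From mathcomp Require Import complex.
From mathcomp Require Import reals sequences exp.

Set Implicit Arguments.
Unset Strict Implicit.
Unset Printing Implicit Defensive.

Import Order.TTheory GRing.Theory Num.Theory.

Local Open Scope ring_scope.
Local Open Scope sesquilinear_scope.
Local Open Scope complex_scope.

Record sgraph := SGraph {
  vertex :> finType;
  adj : rel vertex;
  adj_sym : symmetric adj;
  adj_irr : irreflexive adj }.

(* A directed edge (v, n) is a vertex v together with n : leg v. *)
Definition leg (G : sgraph) (v : G) := {n : G | adj v n}.

Definition rev_leg (G : sgraph) (v : G) (n : leg v) : leg (val n) :=
  exist _ v (etrans (adj_sym (val n) v) (valP n)).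

Definition max_degree (G : sgraph) : nat := \max_(v : G) #|[set n | adj v n]|.

Definition edges (G : sgraph) : {set {set G}} :=
  [set [set v; n] | v in G, n in G & adj v n].

Definition walk (G : sgraph) (v w : G) (k : nat) : Prop :=
  exists s : seq G, [/\ path (@adj G) v s, last v s = w & size s = k].

(* The graph distance of A and B is the (finite) number r; in particular
   A and B are nonempty and lie in a common component. *)
Definition at_distance (G : sgraph) (A B : {set G}) (r : nat) : Prop :=
  (exists v w, [/\ v \in A, w \in B & walk v w r]) /\
  (forall v w k, v \in A -> w \in B -> walk v w k -> (r <= k)%N).

Section LinearAlgebra.
Variable R : realType.

(* All n singular values of A : C^n -> C^m, zeros included: for A = T_v,
   smallest singular value > 0 means that T_v is injective. *)
Definition singval (m n : nat) (A : 'M[R[i]]_(m, n)) (j : 'I_n) : R :=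
  Num.sqrt (complex.Re (spectral_diag (A ^t* *m A) 0 j)).

Definition opnorm (m n : nat) (A : 'M[R[i]]_(m, n)) : R :=
  \big[Num.max/0]_(j < n) singval A j.

Definition trnorm (m n : nat) (A : 'M[R[i]]_(m, n)) : R :=
  \sum_(j < n) singval A j.

(* 0 <= z in R[i] says that z is real and nonnegative, so Hermitian symmetry
   of A is implied. *)
Definition psd (n : nat) (A : 'M[R[i]]_n) : Prop :=
  forall x : 'cV[R[i]]_n, 0 <= (x ^t* *m A *m x) 0 0.

Definition bform (D : nat) (X Y : 'M[R[i]]_D) : R[i] :=
  \sum_i \sum_j X i j * Y i j.

End LinearAlgebra.

Section PEPS.
Variables (R : realType) (G : sgraph) (D : nat) (p : G -> nat).

(* Basis of the virtual space at v, the tensor product of C^D over the legs. *)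
Definition vcfg (v : G) := {ffun leg v -> 'I_D}.

(* T v maps the virtual space at v to the physical space C^(p v). *)
Definition tensors := forall v : G, 'M[R[i]]_(p v, #|vcfg v|).

(* Basis of the physical space of the whole system. *)
Definition pcfg := {dffun forall v : G, 'I_(p v)}.

(* x assigns a value to every leg; contracting the edge {v, w} means summing
   over the x for which its two legs agree. *)
Definition psi (T : tensors) : 'cV[R[i]]_#|pcfg| :=
  \col_s \sum_(x : {dffun forall v : G, vcfg v} |
                 [forall v, forall n : leg v, x v n == x (val n) (rev_leg n)])
     \prod_(v : G) T v ((enum_val s : pcfg) v) (enum_rank (x v)).

Definition expect (T : tensors) (O : 'M[R[i]]_#|pcfg|) : R[i] :=
  ((psi T) ^t* *m O *m psi T) 0 0 / ((psi T) ^t* *m psi T) 0 0.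

(* O = OB \otimes id, with OB acting on the sites of B. *)
Definition supported_on (B : {set G}) (O : 'M[R[i]]_#|pcfg|) : Prop :=
  exists OB : {dffun forall v : {v : G | v \in B}, 'I_(p (val v))} ->
              {dffun forall v : {v : G | v \in B}, 'I_(p (val v))} -> R[i],
  forall s t : pcfg,
    O (enum_rank s) (enum_rank t) =
      if [forall v, (v \notin B) ==> (s v == t v)]
      then OB [ffun v => s (val v)] [ffun v => t (val v)] else 0.

Definition normalized (T : tensors) : Prop :=
  forall v, opnorm (T v) = 1.

Definition injectivity (T : tensors) (eps : R) : Prop :=
  exists delta : R, [/\ 0 <= delta, eps = 1 - delta ^+ 2 &
    forall v j, delta <= singval (T v) j <= 1].

Definition tensor_op (v : G) (X : leg v -> 'M[R[i]]_D) : 'M[R[i]]_#|vcfg v| :=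
  \matrix_(i, j) \prod_(n : leg v)
     X n ((enum_val i : vcfg v) n) ((enum_val j : vcfg v) n).

Definition Etr (T : tensors) (v : G) (X : leg v -> 'M[R[i]]_D) : R[i] :=
  \tr (T v *m tensor_op X *m (T v) ^t*).

(* The matrix with bform (Phi T X) Y = Etr T (Y on leg n, X elsewhere) for
   all Y; X n is not used. *)
Definition Phi (T : tensors) (v : G) (n : leg v) (X : leg v -> 'M[R[i]]_D) :
    'M[R[i]]_D :=
  \matrix_(i, j) Etr T (fun m : leg v => if m == n then delta_mx i j else X m).

Definition messages := forall v : G, leg v -> 'M[R[i]]_D.

Definition message_family (mu : messages) : Prop :=
  forall v (n : leg v), psd (mu v n) /\ \tr (mu v n) = 1.

Definition bp_fixed_point (T : tensors) (mu : messages) : Prop :=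
  message_family mu /\
  forall v (n : leg v),
    let Y := Phi T n (fun m : leg v => mu (val m) (rev_leg m)) in
    mu v n = (\tr Y)^-1 *: Y.

Definition edge_overlap (mu : messages) (v : G) (n : leg v) : R[i] :=
  bform (mu v n) (mu (val n) (rev_leg n)).

(* P_e and its complement for e = {v, n}, oriented from v to n. *)
Definition Pedge (mu : messages) (v : G) (n : leg v) (Y : 'M[R[i]]_D) :
    'M[R[i]]_D :=
  (bform (mu (val n) (rev_leg n)) Y / edge_overlap mu n) *: mu v n.

Definition Pedge_perp (mu : messages) (v : G) (n : leg v) (Y : 'M[R[i]]_D) :
    'M[R[i]]_D :=
  Y - Pedge mu n Y.

(* Contraction of the double-layer (norm) network with the linear map Q v n
   inserted on the edge {v, n}.  A leg carries a pair (ket index, bra index).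
   Every edge is taken once, in the orientation given by the enumeration of
   the vertices; for Pedge and Pedge_perp the opposite orientation gives the
   same edge factor, since the maps of the two orientations are transposes of
   each other for bform. *)
Definition network (T : tensors)
    (Q : forall v : G, leg v -> 'M[R[i]]_D -> 'M[R[i]]_D) : R[i] :=
  \sum_(x : {dffun forall v : G, {ffun leg v -> 'I_D * 'I_D}})
    (\prod_(v : G) Etr T (fun n : leg v => delta_mx (x v n).1 (x v n).2)) *
    (\prod_(v : G) \prod_(n : leg v | (enum_rank v < enum_rank (val n))%N)
       Q v n (delta_mx (x v n).1 (x v n).2)
         (x (val n) (rev_leg n)).1 (x (val n) (rev_leg n)).2).

Definition is_loop (W : {set G}) (F : {set {set G}}) : Prop :=
  [/\ W != set0,
      F \subset edges G,
      forall f, f \in F -> f \subset W,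
      forall v, v \in W -> (2 <= #|[set f in F | v \in f]|)%N &
      forall v w, v \in W -> w \in W ->
        connect [rel a b | [set a; b] \in F] v w].

Definition Zloop (T : tensors) (mu : messages) (F : {set {set G}}) : R[i] :=
  network T (fun v (n : leg v) =>
    if [set v; val n] \in F then Pedge_perp mu n else Pedge mu n) /
  network T (Pedge mu).

Definition loop_decay (T : tensors) (c : R) : Prop :=
  forall mu, bp_fixed_point T mu ->
  forall W F, is_loop W F -> `|Zloop T mu F| <= (expR (- c * #|F|%:R))%:C.

End PEPS.

Definition eps_star (R : realType) (Delta : nat) : R := (2 * Delta%:R - 1)^-1.

Definition c0 (R : realType) (Delta : nat) : R :=
  ln (2 * expR 1 * Delta%:R) + 2^-1.

(* The rate c is uniform over all graphs of maximum degree Delta and all PEPS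
   with injectivity parameter below eps. *)
Definition loop_decay_threshold (R : realType) (D Delta : nat) (eps c : R) :
    Prop :=
  forall (G : sgraph) (p : G -> nat) (T : tensors R D p) (eps' : R),
    max_degree G = Delta -> normalized T -> injectivity T eps' -> eps' < eps ->
    loop_decay T c.

(* Main.v *)
(* An injective tensor satisfies T_v^* T_v = (1 - eps) 1 + F_v with
   0 <= F_v <= eps 1, and the identity on the virtual space of v decouples its
   legs.  Put theta = eps / eps_star = eps (2 Delta - 1).

   Messages.  In the BP update the identity part ignores the traceless
   difference of an incoming message, so only F_v transmits it: each of the at
   most Delta - 1 incoming legs contributes a factor eps, and the normalisation
   1 / (1 - eps) and the change of the normaliser give the total contraction
   factor 2 eps (Delta - 1) / (1 - eps) <= theta per step away from A.

   Expectation values.  Two operator families that differ only on a region W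
   adjacent to neither B nor an unexpanded vertex have the same normalised
   expectation value, because all legs touching W can be exchanged between the
   two networks.  Otherwise expand T_v^* T_v = (1 - eps) 1 + F_v at an
   unexpanded vertex v next to W, in both networks.  Where both pick the
   identity, v disappears; all other terms have relative weight at most 2 eps,
   and v joins W.  Hence the difference is dominated by the potential
   sum_u 2 theta^d(u,B) over the vertices u next to W, which is a
   supersolution since 2 eps (Delta - 1) <= theta. *)

Require Import Defs.
From mathcomp Require Import all_boot all_order all_algebra.
From mathcomp Require Import sesquilinear spectral complex reals sequences exp.
From mathcomp Require Import ring lra.

Set Implicit Arguments.
Unset Strict Implicit.
Unset Printing Implicit Defensive.

Import Order.TTheory GRing.Theory Num.Theory.

Local Open Scope ring_scope.
Local Open Scope sesquilinear_scope.

(** * Positive semidefinite matrices and the trace norm *)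

Section Psd.
Variable C : numClosedFieldType.

(* Over [R[i]] this is convertible to [psd]. *)
Definition psdmx (n : nat) (A : 'M[C]_n) : Prop :=
  forall x : 'cV[C]_n, 0 <= (x^t* *m A *m x) 0 0.

Lemma adjmxM m n p (A : 'M[C]_(m, n)) (B : 'M[C]_(n, p)) :
  (A *m B)^t* = B^t* *m A^t*.
Proof. by rewrite trmx_mul map_mxM. Qed.

Lemma adjmxD m n (A B : 'M[C]_(m, n)) : (A + B)^t* = A^t* + B^t*.
Proof. by rewrite linearD map_mxD. Qed.

Lemma adjmxN m n (A : 'M[C]_(m, n)) : (- A)^t* = - A^t*.
Proof. by rewrite linearN map_mxN. Qed.

Lemma adjmxZ m n a (A : 'M[C]_(m, n)) : (a *: A)^t* = a^* *: A^t*.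
Proof. by rewrite linearZ /= map_mxZ. Qed.

Lemma adjmx1 n : (1%:M : 'M[C]_n)^t* = 1%:M.
Proof. by rewrite trmx1 map_mx1. Qed.

Lemma adjmxE m n (A : 'M[C]_(m, n)) i j : (A^t*) i j = (A j i)^*.
Proof. by rewrite !mxE. Qed.

Lemma sqnormE m (x : 'cV[C]_m) : (x^t* *m x) 0 0 = \sum_i `|x i 0| ^+ 2.
Proof.
rewrite mxE; apply: eq_bigr => i _; rewrite adjmxE.
by rewrite mulrC -normCK.
Qed.

Lemma sqnorm_ge0 m (x : 'cV[C]_m) : 0 <= (x^t* *m x) 0 0.
Proof. by rewrite sqnormE sumr_ge0 // => i _; rewrite exprn_ge0. Qed.

Lemma psd_gram m n (A : 'M[C]_(m, n)) : psdmx (A^t* *m A).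
Proof. by move=> x; rewrite mulmxA -adjmxM -mulmxA sqnorm_ge0. Qed.

Lemma psdD n (A B : 'M[C]_n) : psdmx A -> psdmx B -> psdmx (A + B).
Proof. by move=> a b x; rewrite mulmxDr mulmxDl mxE addr_ge0. Qed.

Lemma psdZ n (a : C) (A : 'M[C]_n) : 0 <= a -> psdmx A -> psdmx (a *: A).
Proof. by move=> a0 b x; rewrite -scalemxAr -scalemxAl mxE mulr_ge0. Qed.

Lemma psd0 n : psdmx (0 : 'M[C]_n).
Proof. by move=> x; rewrite mulmx0 mul0mx mxE. Qed.

Lemma psd1 n : psdmx (1%:M : 'M[C]_n).
Proof. by rewrite -[1%:M]mul1mx -{1}adjmx1; apply: psd_gram. Qed.

Lemma psd_conj m n (A : 'M[C]_n) (B : 'M[C]_(n, m)) :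
  psdmx A -> psdmx (B^t* *m A *m B).
Proof.
move=> hA x.
have -> : x^t* *m (B^t* *m A *m B) *m x = (B *m x)^t* *m A *m (B *m x).
  by rewrite adjmxM !mulmxA.
exact: hA.
Qed.

Lemma psd_sesq n (A : 'M[C]_n) (x : 'cV[C]_n) i :
  (x^t* *m A *m x) i i = \sum_j \sum_k (x j 0)^* * A j k * x k 0.
Proof.
rewrite !ord1 mxE exchange_big /=; apply: eq_bigr => k _.
by rewrite mxE mulr_suml; apply: eq_bigr => j _; rewrite adjmxE.
Qed.

(** Polarisation: the form is real at e_i, e_j, e_i + e_j and e_i + 'i e_j, so A_ij + A_ji and 'i
    (A_ij - A_ji) are real, which determines the conjugate. *)
Lemma psd_herm n (A : 'M[C]_n) : psdmx A -> A^t* = A.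
Proof.
move=> hA; apply/matrixP => i j; rewrite adjmxE.
have q (a b : C) : let x := a *: delta_mx i 0 + b *: delta_mx j 0 : 'cV_n in
    (x^t* *m A *m x) 0 0 =
    a^* * a * A i i + a^* * b * A i j + b^* * a * A j i + b^* * b * A j j.
  move=> x; rewrite /x adjmxD !adjmxZ mulmxDr !mulmxDl -!scalemxAr -!scalemxAl.
  rewrite !trmx_delta !map_delta_mx -!rowE -!colE !mxE; ring.
have re (a b : C) := ger0_real (hA (a *: delta_mx i 0 + b *: delta_mx j 0)).
have rii : A i i \is Num.real.
  have := re 1 0; rewrite q; rewrite conjC1 conjC0.
  by rewrite !(mul0r, mulr0, addr0) !mul1r.
have rjj : A j j \is Num.real.
  have := re 0 1; rewrite q; rewrite conjC1 conjC0.
  by rewrite !(mul0r, mulr0, add0r) !mul1r.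
have r1 : A i j + A j i \is Num.real.
  have := re 1 1; rewrite q conjC1 !mul1r => h.
  have -> : A i j + A j i = (A i i + A i j + A j i + A j j) - A i i - A j j by ring.
  exact: (realB (realB h rii) rjj).
have r2 : 'i * (A i j - A j i) \is Num.real.
  have := re 1 'i; rewrite q conjC1 conjCi !mul1r mulr1 => h.
  have -> : 'i * (A i j - A j i) = (A i i + 'i * A i j + - 'i * A j i
     + - 'i * 'i * A j j) - A i i - A j j.
    by rewrite !mulNr -(expr2 ('i : C)) sqrCi; ring.
  exact: (realB (realB h rii) rjj).
move/CrealP: r1; move/CrealP: r2; rewrite rmorphM rmorphB rmorphD /= conjCi.
move=> e2 e1.
have e3 : (A i j)^* - (A j i)^* = - (A i j - A j i).
  apply: (mulfI (neq0Ci C)); rewrite mulrN -e2; ring.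
have : 2 * (A j i)^* = 2 * A i j.
  transitivity (((A i j)^* + (A j i)^*) - ((A i j)^* - (A j i)^*)); first ring.
  by rewrite e1 e3; ring.
by move/mulfI; apply; rewrite pnatr_eq0.
Qed.

Lemma psd_diag n (A : 'M[C]_n) i : psdmx A -> 0 <= A i i.
Proof.
move=> /(_ (delta_mx i 0)); rewrite trmx_delta map_delta_mx -rowE -colE.
by rewrite !mxE.
Qed.

Lemma psd_tr n (A : 'M[C]_n) : psdmx A -> 0 <= \tr A.
Proof. by move=> hA; apply: sumr_ge0 => i _; apply: psd_diag. Qed.

Lemma psd_spectral n (A : 'M[C]_n) : psdmx A ->
  A = (spectralmx A)^t* *m diag_mx (spectral_diag A) *m spectralmx A /\
  forall j, 0 <= spectral_diag A 0 j.
Proof.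
move=> hA; have hh := psd_herm hA.
have /orthomx_spectralP : A \is normalmx by apply/normalmxP; rewrite hh.
have u := spectral_unitarymx A.
rewrite invmx_unitary //; set U := spectralmx A in u *.
set d := spectral_diag A => e; split=> // j.
have /psd_diag : psdmx (diag_mx d).
  have -> : diag_mx d = U^t*^t* *m A *m U^t*.
    rewrite trmxCK e !mulmxA (unitarymxP u) mul1mx.
    by rewrite -mulmxA (unitarymxP u) mulmx1.
  exact: psd_conj.
by move/(_ j); rewrite mxE eqxx mulr1n.
Qed.

Lemma adjmx_diag n (d : 'rV[C]_n) : (forall j, 0 <= d 0 j) ->
  (diag_mx d)^t* = diag_mx d.
Proof.
move=> d0; rewrite tr_diag_mx map_diag_mx; congr diag_mx.
by apply/rowP => j; rewrite mxE; apply/CrealP; apply: ger0_real.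
Qed.

Lemma psd_factor n (A : 'M[C]_n) : psdmx A -> exists B : 'M[C]_n, A = B^t* *m B.
Proof.
move=> /psd_spectral[e d0].
set d := spectral_diag A in e d0; set U := spectralmx A in e.
exists (diag_mx (map_mx sqrtC d) *m U).
rewrite adjmxM adjmx_diag; last by move=> j; rewrite mxE sqrtC_ge0.
rewrite mulmxA -(mulmxA (U^t*)) mulmx_diag [LHS]e; congr (_ *m diag_mx _ *m _).
by apply/rowP => j; rewrite !mxE -expr2 sqrtCK.
Qed.

Lemma tr_mul_ge0 n (A B : 'M[C]_n) : psdmx A -> psdmx B -> 0 <= \tr (A *m B).
Proof.
move=> /psd_factor[K ->] /psd_factor[L ->].
have -> : \tr (K^t* *m K *m (L^t* *m L)) = \tr ((L *m K^t*)^t* *m (L *m K^t*)).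
  by rewrite adjmxM trmxCK !mulmxA [RHS]mxtrace_mulC !mulmxA.
exact/psd_tr/psd_gram.
Qed.

Lemma adjmx_tr n (A : 'M[C]_n) : \tr (A^t*) = (\tr A)^*.
Proof. by rewrite rmorph_sum; apply: eq_bigr => i _; rewrite adjmxE. Qed.

(** Positivity of the trace of [P] compressed by [V - W], expanded; it plays the role of
    Cauchy-Schwarz. *)
Lemma tr_cross_le m n (P : 'M[C]_m) (V W : 'M[C]_(m, n)) : psdmx P ->
  \tr (W^t* *m P *m V) + (\tr (W^t* *m P *m V))^*
    <= \tr (V^t* *m P *m V) + \tr (W^t* *m P *m W).
Proof.
move=> hP; rewrite -subr_ge0.
have := psd_tr (psd_conj (V - W) hP).
rewrite adjmxD adjmxN !(mulmxDl, mulmxDr) !(mulNmx, mulmxN) opprK.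
rewrite !mxtraceD !raddfN /=.
suff -> : \tr (V^t* *m P *m W) = (\tr (W^t* *m P *m V))^*.
  by congr (_ <= _); ring.
by rewrite -adjmx_tr !adjmxM trmxCK (psd_herm hP) mulmxA.
Qed.

(** The two equations make [W] a partial isometry, so Q = 1 - W W^t* is an orthogonal projection and
    the gap between the sides is the trace of Q P Q. *)
Lemma tr_partial_isometry_le n (P W : 'M[C]_n) (d : 'rV[C]_n) : psdmx P ->
  W^t* *m W = diag_mx d -> W *m diag_mx d = W ->
  \tr (W^t* *m P *m W) <= \tr P.
Proof.
move=> hP e1 e2; rewrite -subr_ge0.
have hQ : (1%:M - W *m W^t*)^t* = 1%:M - W *m W^t*.
  by rewrite adjmxD adjmxN adjmx1 adjmxM trmxCK.
have iQ : (1%:M - W *m W^t*) *m (1%:M - W *m W^t*) = 1%:M - W *m W^t*.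
  rewrite mulmxBl mul1mx mulmxBr mulmx1 mulmxA -(mulmxA W) e1 e2 subrr subr0 //.
have := psd_tr (psd_conj (1%:M - W *m W^t*) hP).
rewrite hQ mxtrace_mulC mulmxA iQ mulmxBl mul1mx raddfB /=.
by rewrite -!mulmxA mxtrace_mulC -mulmxA.
Qed.

(* The sum of the singular values is [\tr (W^t* *m A *m V)], where the columns of
   [V] are eigenvectors of [A^t* *m A] and those of [W] are their normalised
   images under [A] (or zero). *)
Lemma sum_sqrt_gram_le n (A P N : 'M[C]_n) : psdmx P -> psdmx N -> A = P - N ->
  \sum_j sqrtC (spectral_diag (A^t* *m A) 0 j) <= \tr P + \tr N.
Proof.
move=> hP hN eA.
have [e d0] := psd_spectral (psd_gram A).
have u := spectral_unitarymx (A^t* *m A).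
set d := spectral_diag _ in e d0 *; set U := spectralmx _ in e u.
pose V := U^t*.
have VV : V *m V^t* = 1%:M.
  by rewrite /V trmxCK; apply: mulmx1C; apply/unitarymxP.
have gB : (A *m V)^t* *m (A *m V) = diag_mx d.
  rewrite adjmxM /V trmxCK !mulmxA -(mulmxA U) e !mulmxA (unitarymxP u) mul1mx.
  by rewrite -mulmxA (unitarymxP u) mulmx1.
pose r : 'rV[C]_n := \row_j (sqrtC (d 0 j))^-1.
have r0 j : 0 <= r 0 j by rewrite mxE invr_ge0 sqrtC_ge0.
pose W := A *m V *m diag_mx r.
have aW : W^t* = diag_mx r *m (A *m V)^t* by rewrite [LHS]adjmxM adjmx_diag.
pose q : 'rV[C]_n := \row_j (d 0 j != 0)%:R.
have sd j : d 0 j = sqrtC (d 0 j) * sqrtC (d 0 j) by rewrite -expr2 sqrtCK.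
have eWB : W^t* *m A *m V = diag_mx (map_mx sqrtC d).
  rewrite aW -!mulmxA gB mulmx_diag; congr diag_mx; apply/rowP => j.
  rewrite !mxE [X in _ * X]sd; have [->|nz] := eqVneq (sqrtC (d 0 j)) 0.
    by rewrite !mulr0.
  by rewrite mulKf.
have eWW : W^t* *m W = diag_mx q.
  rewrite /W !mulmxA eWB mulmx_diag; congr diag_mx; apply/rowP => j.
  rewrite !mxE; have [e0|nz] := eqVneq (d 0 j) 0.
    by rewrite e0 sqrtC0 mul0r.
  by rewrite mulfV ?sqrtC_eq0.
have eWq : W *m diag_mx q = W.
  rewrite /W -mulmxA mulmx_diag; congr (_ *m diag_mx _); apply/rowP => j.
  rewrite !mxE; have [e0|nz] := eqVneq (d 0 j) 0.
    by rewrite e0 sqrtC0 invr0 mul0r.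
  by rewrite mulr1.
have eS : \sum_j sqrtC (d 0 j) = \tr (W^t* *m P *m V) - \tr (W^t* *m N *m V).
  rewrite -raddfB /= -mulmxBl -mulmxBr -eA eWB mxtrace_diag.
  by apply: eq_bigr => j _; rewrite mxE.
have rS : \sum_j sqrtC (d 0 j) \is Num.real.
  by apply: ger0_real; apply: sumr_ge0 => j _; rewrite sqrtC_ge0.
have trV X : \tr (V^t* *m X *m V) = \tr X.
  by rewrite mxtrace_mulC mulmxA VV mul1mx.
(* The cross bound for [P] with [W] and for [N] with [- W] bounds twice the real sum by twice the
   two traces. *)
have := tr_cross_le V W hP; have := tr_cross_le V (- W) hN.
rewrite adjmxN !mulNmx !mulmxN !raddfN /= opprK !trV.
have := tr_partial_isometry_le hP eWW eWq; have := tr_partial_isometry_le hN eWW eWq.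
move=> a1 a2 a3 a4.
have a5 := le_trans a3 (lerD (lexx _) a1).
have a6 := le_trans a4 (lerD (lexx _) a2).
have := lerD a6 a5; rewrite addrACA -eS -(rmorphN (@Num.conj C)) -rmorphD -eS /=.
rewrite (CrealP rS) -!mulr2n -mulrnDl lerMn2r /= //.
Qed.

End Psd.

Lemma sum_enum_val (V : nmodType) (I : finType) (F : I -> V) :
  \sum_(i < #|I|) F (enum_val i) = \sum_i F i.
Proof. by rewrite [RHS](reindex _ (onW_bij _ (@enum_val_bij _))). Qed.

(** * Bounds on eigenvalues as operator inequalities *)

Section Loewner.
Variable C : numClosedFieldType.

Lemma psd_diag_mx n (d : 'rV[C]_n) : (forall j, 0 <= d 0 j) -> psdmx (diag_mx d).
Proof.
move=> d0.
have -> : diag_mx d = (diag_mx (map_mx sqrtC d))^t* *m diag_mx (map_mx sqrtC d).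
  rewrite adjmx_diag => [|j]; last by rewrite mxE sqrtC_ge0.
  rewrite mulmx_diag; congr diag_mx; apply/rowP => j.
  by rewrite !mxE -expr2 sqrtCK.
exact: psd_gram.
Qed.

Lemma psd_sub_scalar n (A : 'M[C]_n) a : psdmx A ->
  (forall j, a <= spectral_diag A 0 j) -> psdmx (A - a%:M).
Proof.
move=> /psd_spectral[e _] ha; have u := spectral_unitarymx A.
set U := spectralmx A in e u; set d := spectral_diag A in e ha.
have -> : A - a%:M = U^t* *m diag_mx (d - const_mx a) *m U.
  rewrite raddfB /= mulmxBr mulmxBl -e diag_const_mx.
  rewrite -scalemx1 -scalemxAr mulmx1 -scalemxAl (mulmx1C (unitarymxP u)) //.
by apply/psd_conj/psd_diag_mx => j; rewrite !mxE subr_ge0.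
Qed.

Lemma psd_scalar_sub n (A : 'M[C]_n) a : psdmx A ->
  (forall j, spectral_diag A 0 j <= a) -> psdmx (a%:M - A).
Proof.
move=> /psd_spectral[e _] ha; have u := spectral_unitarymx A.
set U := spectralmx A in e u; set d := spectral_diag A in e ha.
have -> : a%:M - A = U^t* *m diag_mx (const_mx a - d) *m U.
  rewrite raddfB /= mulmxBr mulmxBl -e diag_const_mx.
  rewrite -scalemx1 -scalemxAr mulmx1 -scalemxAl (mulmx1C (unitarymxP u)) //.
by apply/psd_conj/psd_diag_mx => j; rewrite !mxE subr_ge0.
Qed.

End Loewner.

(** * Contraction of the belief-propagation update *)

Section Tensor.
Variables (C : numClosedFieldType) (L : finType) (D : nat).
Implicit Types (X Y : L -> 'M[C]_D) (n m : L).

(** [tensor_op] for an arbitrary finite set of legs and an arbitrary closed field. *)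
Definition tensmx X : 'M[C]_#|{ffun L -> 'I_D}| :=
  \matrix_(i, j) \prod_(n : L)
     X n ((enum_val i : {ffun L -> 'I_D}) n) ((enum_val j : {ffun L -> 'I_D}) n).

Lemma eq_tensmx X Y : X =1 Y -> tensmx X = tensmx Y.
Proof. by move=> e; apply/matrixP => i j; rewrite !mxE; apply: eq_bigr => n _; rewrite e. Qed.

Lemma tensmx_mul X Y : tensmx (fun n => X n *m Y n) = tensmx X *m tensmx Y.
Proof.
apply/matrixP => i j; rewrite !mxE.
under eq_bigr do rewrite mxE; rewrite bigA_distr_bigA /= -(sum_enum_val (I := {ffun L -> 'I_D})).
by apply: eq_bigr => k _; rewrite !mxE -big_split.
Qed.

Lemma tensmx_adj X : (tensmx X)^t* = tensmx (fun n => (X n)^t*).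
Proof.
apply/matrixP => i j; rewrite adjmxE !mxE rmorph_prod.
by apply: eq_bigr => n _; rewrite adjmxE.
Qed.

Lemma tensmx_tr X : \tr (tensmx X) = \prod_n \tr (X n).
Proof.
rewrite /mxtrace bigA_distr_bigA /= -(sum_enum_val (I := {ffun L -> 'I_D})).
by apply: eq_bigr => k _; rewrite mxE.
Qed.

(** A tensor product of Gram matrices is the Gram matrix of the tensor product of the factors. *)
Lemma tensmx_psd X : (forall n, psdmx (X n)) -> psdmx (tensmx X).
Proof.
move=> h; have [B hB] : exists B : L -> 'M[C]_D, forall n, X n = (B n)^t* *m B n.
  have h' n : exists B : 'M[C]_D, X n == B^t* *m B.
    by have [B ->] := psd_factor (h n); exists B.
  by exists (fun n => xchoose (h' n)) => n; apply/eqP/(xchooseP (h' n)).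
by rewrite (eq_tensmx hB) tensmx_mul -tensmx_adj; apply: psd_gram.
Qed.

Definition upd X n (Y : 'M[C]_D) : L -> 'M[C]_D := fun m => if m == n then Y else X m.

Lemma upd_psd X n (Y : 'M[C]_D) : (forall m, m != n -> psdmx (X m)) -> psdmx Y ->
  forall m, psdmx (upd X n Y m).
Proof. by move=> hX hY m; rewrite /upd; case: eqVneq => // /hX. Qed.

Lemma tensmx_updE X n (Y : 'M[C]_D) i j : tensmx (upd X n Y) i j =
  Y ((enum_val i : {ffun L -> 'I_D}) n) ((enum_val j : {ffun L -> 'I_D}) n) *
  \prod_(m | m != n)
     X m ((enum_val i : {ffun L -> 'I_D}) m) ((enum_val j : {ffun L -> 'I_D}) m).
Proof.
rewrite mxE (bigD1 n) //= {1}/upd eqxx; congr (_ * _).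
by apply: eq_bigr => m /negPf nm; rewrite /upd nm.
Qed.

Lemma tensmx_updB X n (Y Z : 'M[C]_D) :
  tensmx (upd X n (Y - Z)) = tensmx (upd X n Y) - tensmx (upd X n Z).
Proof.
by apply/matrixP => i j; rewrite [RHS]mxE [X in _ = _ + X]mxE !tensmx_updE !mxE mulrBl.
Qed.

Lemma tensmx_upd_sum X n (I : finType) (c : I -> C) (Y : I -> 'M[C]_D) :
  tensmx (upd X n (\sum_k c k *: Y k)) = \sum_k c k *: tensmx (upd X n (Y k)).
Proof.
apply/matrixP => i j; rewrite tensmx_updE !summxE mulr_suml.
by apply: eq_bigr => k _; rewrite mxE [RHS]mxE tensmx_updE mulrA.
Qed.

Variable n : L.
Implicit Type M : 'M[C]_#|{ffun L -> 'I_D}|.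

(** [Phi] with an arbitrary [M] in place of the Gram matrix of the tensor; linearity in [M] lets the
    identity part be split off. *)
Definition phi M X : 'M[C]_D :=
  \matrix_(i, j) \tr (M *m tensmx (upd X n (delta_mx i j))).

Lemma phiE M X (Y : 'M[C]_D) :
  \tr (M *m tensmx (upd X n Y)) = \sum_i \sum_j Y i j * phi M X i j.
Proof.
rewrite {1}(matrix_sum_delta Y) pair_bigA /=.
rewrite (tensmx_upd_sum _ _ (fun k : 'I_D * 'I_D => Y k.1 k.2)
  (fun k => delta_mx k.1 k.2)) mulmx_sumr raddf_sum /=.
by rewrite [RHS]pair_bigA; apply: eq_bigr => -[i j] _ /=; rewrite -scalemxAr mxtraceZ mxE.
Qed.

Lemma eq_phi M X Y : (forall m, m != n -> X m = Y m) -> phi M X = phi M Y.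
Proof.
move=> e; apply/matrixP => i j; rewrite !mxE; congr (\tr (_ *m _)).
by apply: eq_tensmx => m; rewrite /upd; case: eqVneq => // /e.
Qed.

Lemma phiD M N X : phi (M + N) X = phi M X + phi N X.
Proof. by apply/matrixP => i j; rewrite !mxE mulmxDl mxtraceD. Qed.

Lemma phiZ a M X : phi (a *: M) X = a *: phi M X.
Proof. by apply/matrixP => i j; rewrite !mxE -scalemxAl mxtraceZ. Qed.

(** The quadratic form at [x] is the trace of [M] against a tensor product with a rank-one positive
    operator on leg [n]. The transpose in [Y] reflects that the bond contraction has no complex
    conjugation. *)
Lemma phi_psd M X : psdmx M -> (forall m, m != n -> psdmx (X m)) ->
  psdmx (phi M X).
Proof.
move=> hM hX x; rewrite psd_sesq.
pose Y : 'M[C]_D := (x^T)^t* *m x^T.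
have -> : \sum_j \sum_k (x j 0)^* * phi M X j k * x k 0 =
    \tr (M *m tensmx (upd X n Y)).
  rewrite phiE; apply: eq_bigr => j _; apply: eq_bigr => k _.
  by rewrite [Y j k]mxE big_ord1 adjmxE !mxE; ring.
by apply: tr_mul_ge0 => //; apply/tensmx_psd/upd_psd => //; apply: psd_gram.
Qed.

(** The identity decouples the legs: the other messages enter only through their traces. *)
Lemma phi1 X : phi 1%:M X = (\prod_(m | m != n) \tr (X m))%:M.
Proof.
apply/matrixP => i j; rewrite !mxE mul1mx tensmx_tr (bigD1 n) //= {1}/upd eqxx.
have -> : \tr (delta_mx i j : 'M[C]_D) = (i == j)%:R.
  rewrite /mxtrace (bigD1 i) //= mxE eqxx big1 ?addr0 // => k /negPf ne.
  by rewrite mxE ne.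
rewrite mulrC -[RHS]mulr_natr; congr (_ * _); apply: eq_bigr => m /negPf ne.
by rewrite /upd ne.
Qed.

Lemma tr_phi1 X : \tr (phi 1%:M X) = D%:R * \prod_(m | m != n) \tr (X m).
Proof. by rewrite phi1 mxtrace_scalar mulr_natl. Qed.

Lemma phi_updB M X m (Y Z : 'M[C]_D) : m != n ->
  phi M (upd X m (Y - Z)) = phi M (upd X m Y) - phi M (upd X m Z).
Proof.
move=> mn; apply/matrixP => i j.
have sw (B : 'M[C]_D) : tensmx (upd (upd X m B) n (delta_mx i j)) =
    tensmx (upd (upd X n (delta_mx i j)) m B).
  by apply: eq_tensmx => k; rewrite /upd; case: eqVneq => // ->;
     rewrite eq_sym (negPf mn).
by rewrite !mxE !sw tensmx_updB mulmxBr raddfB.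
Qed.

(* Implies that the trace norm of [H] is at most [2 * b]; unlike the trace norm,
   it is visibly preserved by positive maps. *)
Definition trace_diff (H : 'M[C]_D) (b : C) :=
  exists P N, [/\ psdmx P, psdmx N, H = P - N, \tr P <= b & \tr N <= b].

Lemma trace_diffD H K b c : trace_diff H b -> trace_diff K c ->
  trace_diff (H + K) (b + c).
Proof.
move=> [P [N [hP hN -> tP tN]]] [P' [N' [hP' hN' -> tP' tN']]].
exists (P + P'), (N + N'); split; rewrite ?mxtraceD ?lerD //; try exact: psdD.
by rewrite opprD addrACA.
Qed.

Section Contraction.
Variables (E : 'M[C]_#|{ffun L -> 'I_D}|) (eps : C).
Hypotheses (D_gt0 : (0 < D)%N) (eps_ge0 : 0 <= eps) (eps_lt1 : eps < 1).
Hypothesis E_ge : psdmx (E - (1 - eps)%:M).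
Hypothesis E_le : psdmx (1%:M - E).

Let F := E - (1 - eps)%:M.

Let EF : E = (1 - eps) *: 1%:M + F.
Proof. by rewrite scalemx1 addrC subrK. Qed.

Let E_psd : psdmx E.
Proof.
rewrite EF; apply: psdD => //; apply: psdZ; last exact: psd1.
by rewrite subr_ge0 ltW.
Qed.

Let tr_phiF X : (forall m, m != n -> psdmx (X m)) ->
  \tr (phi F X) <= eps * \tr (phi 1%:M X).
Proof.
move=> hX; rewrite -subr_ge0.
have := psd_tr (phi_psd E_le hX).
have -> : 1%:M - E = eps *: 1%:M + (- 1) *: F.
  by rewrite /F !scalemx1 scaleN1r opprB addrA -raddfD /= [eps + _]addrC subrK.
by rewrite phiD !phiZ mxtraceD !mxtraceZ mulN1r.
Qed.

Lemma tr_phi_ge X : (forall m, m != n -> psdmx (X m)) ->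
  (forall m, m != n -> \tr (X m) = 1) -> (1 - eps) * D%:R <= \tr (phi E X).
Proof.
move=> hX tX; rewrite EF phiD phiZ mxtraceD mxtraceZ tr_phi1 big1 // mulr1.
by rewrite lerDl; apply/psd_tr/phi_psd.
Qed.

(** The identity part of [E] sees only the traces of [P] and [N], which agree, so the difference is
    transmitted by [F] alone, and [F] is bounded by [eps]. *)
Lemma phi_diff_leg X m (P N : 'M[C]_D) b : m != n ->
  (forall k, k != n -> psdmx (X k)) -> (forall k, k != n -> \tr (X k) = 1) ->
  psdmx P -> psdmx N -> \tr P = \tr N -> \tr P <= b ->
  trace_diff (phi E (upd X m P) - phi E (upd X m N)) (eps * (D%:R * b)).
Proof.
move=> mn hX tX hP hN tPN tPb.
have pr B : \prod_(k | k != n) \tr (upd X m B k) = \tr B.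
  rewrite (bigD1 m) //= {1}/upd eqxx big1 ?mulr1 // => k /andP[kn /negPf km].
  by rewrite /upd km tX.
have hU B : psdmx B -> forall k, k != n -> psdmx (upd X m B k).
  by move=> hB k kn; rewrite /upd; case: eqVneq => // _; apply: hX.
exists (phi F (upd X m P)), (phi F (upd X m N)); split.
- by apply: phi_psd => //; apply: hU.
- by apply: phi_psd => //; apply: hU.
- rewrite EF !phiD !phiZ !phi1 !pr tPN opprD addrACA subrr add0r //.
- apply: le_trans (tr_phiF (hU _ hP)) _.
  by rewrite tr_phi1 pr !ler_wpM2l.
- apply: le_trans (tr_phiF (hU _ hN)) _.
  by rewrite tr_phi1 pr -tPN !ler_wpM2l.
Qed.

Variables (X X' : L -> 'M[C]_D) (b : C).
Hypothesis X_psd : forall m, m != n -> psdmx (X m).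
Hypothesis X_tr : forall m, m != n -> \tr (X m) = 1.
Hypothesis X'_psd : forall m, m != n -> psdmx (X' m).
Hypothesis X'_tr : forall m, m != n -> \tr (X' m) = 1.
Hypothesis X_diff : forall m, m != n -> trace_diff (X' m - X m) b.

Lemma phi_diff :
  trace_diff (phi E X' - phi E X) ((#|L|.-1)%:R * (eps * (D%:R * b))).
Proof.
(* Hybrid argument: [hyb s] uses the new messages on [s], and the legs are switched one at a
   time. *)
pose hyb (s : seq L) m := if m \in s then X' m else X m.
have key s : n \notin s ->
    trace_diff (phi E (hyb s) - phi E X) ((size s)%:R * (eps * (D%:R * b))).
  elim: s => [_|m s IHs].
    rewrite mul0r subrr; exists 0, 0; split; try exact: psd0; by rewrite ?subrr ?mxtrace0.
  rewrite inE negb_or eq_sym => /andP[mn /IHs{}IHs].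
  rewrite -(subrK (phi E (hyb s)) (phi E (hyb (m :: s)))) -addrA.
  rewrite [size _]/= -[_.+1]addn1 addnC natrD mulrDl mul1r.
  apply: trace_diffD IHs.
  have hs k : k != n -> psdmx (hyb s k).
    by move=> kn; rewrite /hyb; case: ifP => _; [apply: X'_psd|apply: X_psd].
  have ts k : k != n -> \tr (hyb s k) = 1.
    by move=> kn; rewrite /hyb; case: ifP => _; [apply: X'_tr|apply: X_tr].
  have [P [N [hP hN e tP tN]]] := X_diff mn.
  have tPN : \tr P = \tr N.
    by apply/eqP; rewrite -subr_eq0 -raddfB /= -e raddfB /= X'_tr // X_tr // subrr.
  have := phi_diff_leg mn hs ts hP hN tPN tP.
  (* A repeated leg changes nothing; [P1] then serves as both parts of the zero difference, within
     the bound of one step. *)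
  have [ms|ms] := boolP (m \in s).
    move=> [P1 [N1 [hP1 hN1 _ tP1 tN1]]].
    have -> : phi E (hyb (m :: s)) = phi E (hyb s).
      by apply: eq_phi => k _; rewrite /hyb inE; case: eqVneq => // ->; rewrite ms.
    exists P1, P1; rewrite !subrr; split=> //.
  rewrite -phi_updB // -e phi_updB //.
  have -> : phi E (upd (hyb s) m (X' m)) = phi E (hyb (m :: s)).
    by apply: eq_phi => k _; rewrite /hyb /upd inE; case: eqVneq => // ->.
  have -> : phi E (upd (hyb s) m (X m)) = phi E (hyb s) => //.
  by apply: eq_phi => k _; rewrite /hyb /upd; case: eqVneq => // ->; rewrite (negPf ms).
have := key (enum (predC1 n)); rewrite mem_enum inE eqxx => /(_ isT).
rewrite -cardE cardC1 => h.
rewrite (_ : phi E X' = phi E (hyb (enum (predC1 n)))) //.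
by apply: eq_phi => m mn; rewrite /hyb mem_enum inE mn.
Qed.

(** With m' = Y'/y', the difference is ((Y' - Y) - (y' - y) m') / y: the change of the normaliser
    costs as much as that of the update, hence the 2. Since y is at least (1 - eps) D, the dimension
    cancels. *)
Lemma normalized_phi_diff :
  trace_diff ((\tr (phi E X'))^-1 *: phi E X' - (\tr (phi E X))^-1 *: phi E X)
    (2 * eps / (1 - eps) * (#|L|.-1)%:R * b).
Proof.
have [P [N [hP hN e tP tN]]] := phi_diff.
have e1 : 0 < 1 - eps by rewrite subr_gt0.
have D0 : 0 < D%:R :> C by rewrite ltr0n.
have yge := tr_phi_ge X_psd X_tr; have y'ge := tr_phi_ge X'_psd X'_tr.
have hY' := phi_psd E_psd X'_psd.
have ey : \tr (phi E X') - \tr (phi E X) = \tr P - \tr N by rewrite -!raddfB /= e.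
set Y := phi E X in e yge ey *; set Y' := phi E X' in e y'ge hY' ey *.
set y := \tr Y in yge ey *; set y' := \tr Y' in y'ge ey *.
set w := _ * (eps * _) in tP tN.
have y0 : 0 < y by apply: lt_le_trans yge; rewrite mulr_gt0.
have y'0 : 0 < y' by apply: lt_le_trans y'ge; rewrite mulr_gt0.
have w0 : 0 <= w by apply: le_trans (psd_tr hP) tP.
have bd : y^-1 * (w + w) <= 2 * eps / (1 - eps) * #|L|.-1%:R * b.
  apply: (@le_trans _ _ (((1 - eps) * D%:R)^-1 * (w + w))).
    by rewrite ler_wpM2r ?addr_ge0 // lef_pV2 ?posrE // mulr_gt0.
  by rewrite le_eqVlt; apply/orP; left; apply/eqP; rewrite /w; field;
     rewrite !gt_eqF.
pose m' := y'^-1 *: Y'.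
have tm' : \tr m' = 1 by rewrite mxtraceZ mulVf // gt_eqF.
have hm' : psdmx m' by apply: psdZ => //; rewrite invr_ge0 ltW.
exists (y^-1 *: (P + \tr N *: m')), (y^-1 *: (N + \tr P *: m')); split.
- apply: psdZ; first by rewrite invr_ge0 ltW.
  by apply: psdD => //; apply: psdZ => //; apply: psd_tr.
- apply: psdZ; first by rewrite invr_ge0 ltW.
  by apply: psdD => //; apply: psdZ => //; apply: psd_tr.
- rewrite -scalerBr opprD addrACA -e -scalerBl.
  have -> : \tr N - \tr P = y - y' by rewrite -opprB -ey opprB.
  rewrite scalerDr scalerBr scalerA mulrBr mulVf ?gt_eqF // scalerBl scale1r.
  rewrite /m' scalerA -[y^-1 * y' * _]mulrA mulfV ?gt_eqF // mulr1.
  by rewrite [RHS]addrC addrA subrK.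
- apply: le_trans bd; rewrite mxtraceZ mxtraceD mxtraceZ tm' mulr1.
  by apply: ler_wpM2l; rewrite ?invr_ge0 ?(ltW y0) // lerD.
- apply: le_trans bd; rewrite mxtraceZ mxtraceD mxtraceZ tm' mulr1.
  by apply: ler_wpM2l; rewrite ?invr_ge0 ?(ltW y0) // lerD.
Qed.

End Contraction.
End Tensor.

(** * Double-layer networks *)

(** Distributivity when the index type depends on the factor, reduced to the non-dependent law on
    the tagged sum of the index types. *)
Lemma prod_sum_dffun (R : comNzRingType) (I : finType) (J : I -> finType)
    (f : forall i, J i -> R) :
  \prod_i \sum_(j : J i) f i j =
  \sum_(k : {dffun forall i, J i}) \prod_i f i (k i).
Proof.
rewrite [RHS](reindex _ (onW_bij _ (@dffun_of_fprod_bij _ _))) /=.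
transitivity (\sum_(t : fprod J) \prod_i [ffun j => f i j] (t i)); last first.
  by apply: eq_bigr => t _; apply: eq_bigr => i _; rewrite !ffunE.
rewrite (@big_fprod _ _ _ _ _ I J (fun i => [ffun j => f i j])).
transitivity (\prod_i \sum_(j in tagged_with J i) untag 0 (f i) j).
  by apply: eq_bigr => i _; rewrite -big_tag.
rewrite bigA_distr_big_dep; apply: eq_bigr => g /familyP hg.
apply: eq_bigr => i _; have /eqP e : tag (g i) == i := hg i.
by rewrite !(untagE _ _ e) ffunE.
Qed.

Section Network.
Variables (C : numClosedFieldType) (G : sgraph) (D : nat).
Implicit Types (v w : G) (B W U : {set G}).

Let cfg := {dffun forall v : G, vcfg D v}.
Let ops := forall v : G, 'M[C]_#|vcfg D v|.

Definition consistent (x : cfg) : bool :=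
  [forall v, forall n : leg v, x v n == x (val n) (rev_leg n)].

(** The norm network with an arbitrary operator [X v] in place of the Gram matrix of each tensor;
    [x] is the bra layer and [y] the ket layer. *)
Definition netval (X : ops) : C :=
  \sum_(x : cfg | consistent x) \sum_(y : cfg | consistent y)
     \prod_v X v (enum_rank (x v)) (enum_rank (y v)).

Lemma eq_netval (X Y : ops) : (forall v, X v = Y v) -> netval X = netval Y.
Proof.
move=> e; apply: eq_bigr => x _; apply: eq_bigr => y _.
by apply: eq_bigr => v _; rewrite e.
Qed.

Lemma netval_linear (X X1 X2 : ops) a v :
  (forall w, w != v -> X w = X1 w /\ X w = X2 w) ->
  X v = a *: X1 v + X2 v -> netval X = a * netval X1 + netval X2.
Proof.
move=> e ev; rewrite mulr_sumr -big_split; apply: eq_bigr => x _ /=.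
rewrite mulr_sumr -big_split; apply: eq_bigr => y _ /=.
rewrite (bigD1 v) //= [X in _ = a * X + _](bigD1 v) //=.
rewrite [X in _ = _ + X](bigD1 v) //= ev mxE [X in (X + _) * _]mxE mulrDl mulrA.
by congr (_ * _ + _ * _); apply: eq_bigr => w /e[e1 e2]; rewrite -?e1 -?e2.
Qed.

Lemma eq_vcfg v (x y : vcfg D v) : (x == y) = [forall n, x n == y n].
Proof.
apply/eqP/forallP => [-> //|h]; apply/ffunP => n; exact/eqP.
Qed.

Section Exchange.
Variable W : {set G}.

Definition mix (x x' : cfg) : cfg :=
  [ffun v => [ffun n : leg v =>
     if (v \in W) || (val n \in W) then x' v n else x v n]].

Lemma mixE x x' v (n : leg v) :
  mix x x' v n = if (v \in W) || (val n \in W) then x' v n else x v n.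
Proof. by rewrite !ffunE. Qed.

Lemma mix_in x x' v : v \in W -> mix x x' v = x' v.
Proof. by move=> vW; apply/ffunP => n; rewrite mixE vW. Qed.

Lemma mix_out x x' v : v \notin W -> (forall n : leg v, val n \notin W) ->
  mix x x' v = x v.
Proof.
by move=> vW nW; apply/ffunP => n; rewrite mixE (negPf vW) (negPf (nW n)).
Qed.

(** Whether a leg is exchanged depends only on its unordered edge, so both legs of an edge come from
    the same configuration. *)
Lemma mix_consistent x x' : consistent x -> consistent x' ->
  consistent (mix x x').
Proof.
move=> /forallP cx /forallP cx'; apply/forallP => v; apply/forallP => n.
rewrite !mixE /= orbC; case: ifP => _.
  exact: (forallP (cx' v)).
exact: (forallP (cx v)).
Qed.

Lemma mixK x x' : mix (mix x x') (mix x' x) = x.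
Proof.
by apply/ffunP => v; apply/ffunP => n; rewrite !mixE; case: ifP => // h; rewrite ?h.
Qed.

(* Exchanging all legs that touch [W] between the two networks swaps the factors
   of the vertices in [W]; an identity vertex does not notice which of its legs
   are exchanged. *)
Lemma netval_exchange (X X' Y Y' : ops) :
  (forall v, v \in W -> X v = Y v /\ X' v = Y' v) ->
  (forall v, v \notin W -> X v = X' v /\ Y v = Y' v) ->
  (forall v (n : leg v), v \notin W -> val n \in W -> X v = 1%:M /\ Y v = 1%:M) ->
  netval X * netval Y' = netval X' * netval Y.
Proof.
move=> hW hN h1.
have ex (A B : ops) : netval A * netval B =
    \sum_(q : (cfg * cfg) * (cfg * cfg) |
        (consistent q.1.1 && consistent q.1.2) &&
        (consistent q.2.1 && consistent q.2.2))
      \prod_v (A v (enum_rank (q.1.1 v)) (enum_rank (q.1.2 v)) *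
               B v (enum_rank (q.2.1 v)) (enum_rank (q.2.2 v))).
  rewrite /netval !pair_big /= mulr_suml.
  rewrite -(pair_big (fun q : cfg * cfg => consistent q.1 && consistent q.2)
      (fun q : cfg * cfg => consistent q.1 && consistent q.2)
      (fun q q' : cfg * cfg => \prod_v (A v (enum_rank (q.1 v)) (enum_rank (q.2 v)) *
        B v (enum_rank (q'.1 v)) (enum_rank (q'.2 v))))) /=.
  apply: eq_bigr => q _; rewrite mulr_sumr; apply: eq_bigr => q' _.
  by rewrite big_split.
rewrite !ex.
pose sw (q : (cfg * cfg) * (cfg * cfg)) :=
  ((mix q.1.1 q.2.1, mix q.1.2 q.2.2), (mix q.2.1 q.1.1, mix q.2.2 q.1.2)).
have swK : involutive sw by case=> [[x y] [x' y']]; rewrite /sw /= !mixK.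
have swc q : (consistent q.1.1 && consistent q.1.2) &&
      (consistent q.2.1 && consistent q.2.2) ->
      (consistent (sw q).1.1 && consistent (sw q).1.2) &&
      (consistent (sw q).2.1 && consistent (sw q).2.2).
  by move=> /andP[/andP[c1 c2] /andP[c3 c4]]; rewrite /= !mix_consistent.
rewrite [LHS](reindex _ (onW_bij _ (inv_bij swK))).
apply: eq_big => [q|q _].
  by apply/idP/idP => h; [rewrite -[q]swK|]; apply: swc.
apply: eq_bigr => v _; rewrite /sw [(_, _).1]/= [(_, _).2]/=.
case: q => [[x y] [x' y']] /=.
have [vW|vW] := boolP (v \in W).
  by rewrite !mix_in // (hW v vW).1 (hW v vW).2 mulrC.
have [/existsP[n nW]|/existsPn nW] := boolP [exists n : leg v, val n \in W]; last first.
  by rewrite !mix_out // (hN v vW).1 (hN v vW).2.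
(* At an identity vertex next to [W] the factor says that the two layers agree in both networks; leg
   by leg this survives the exchange. *)
have [e1 e2] := h1 v n vW nW; rewrite -(hN v vW).1 -(hN v vW).2 e1 e2.
rewrite !mxE !(inj_eq enum_rank_inj) !eq_vcfg -!natrM !mulnb.
congr ((nat_of_bool _)%:R).
apply/andP/andP => -[/forallP a /forallP b]; split; apply/forallP => m;
  move: (a m) (b m); rewrite !mixE; case: ifP => //.
Qed.

End Exchange.

Section Amplitude.
Variable q : G -> nat.

(** The physical dimensions [q] are free, so that square roots of arbitrary positive site operators
    can serve as tensors. *)
Definition amp (A : forall v, 'M[C]_(q v, #|vcfg D v|))
    (k : {dffun forall v : G, 'I_(q v)}) : C :=
  \sum_(x : cfg | consistent x) \prod_v A v (k v) (enum_rank (x v)).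

Lemma netval_amp (A A' : forall v, 'M[C]_(q v, #|vcfg D v|)) :
  netval (fun v => (A v)^t* *m A' v) = \sum_k (amp A k)^* * amp A' k.
Proof.
transitivity (\sum_(x : cfg | consistent x) \sum_(y : cfg | consistent y)
    \sum_(k : {dffun forall v : G, 'I_(q v)})
      (\prod_v A v (k v) (enum_rank (x v)))^* *
      \prod_v A' v (k v) (enum_rank (y v))).
  apply: eq_bigr => x _; apply: eq_bigr => y _.
  under eq_bigr do rewrite mxE; rewrite prod_sum_dffun; apply: eq_bigr => k _.
  by rewrite rmorph_prod -big_split; apply: eq_bigr => v _; rewrite adjmxE.
under eq_bigr do rewrite exchange_big.
rewrite exchange_big; apply: eq_bigr => k _ /=.
rewrite rmorph_sum mulr_suml; apply: eq_bigr => x _.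
by rewrite mulr_sumr.
Qed.

End Amplitude.

Lemma amp_mul (q r : G -> nat) (Y : forall v, 'M[C]_(r v, q v))
    (A : forall v, 'M[C]_(q v, #|vcfg D v|)) k :
  amp (fun v => Y v *m A v) k =
  \sum_(t : {dffun forall v : G, 'I_(q v)}) (\prod_v Y v (k v) (t v)) * amp A t.
Proof.
under [RHS]eq_bigr do rewrite mulr_sumr.
rewrite exchange_big; apply: eq_bigr => x _ /=.
under eq_bigr do rewrite mxE; rewrite prod_sum_dffun; apply: eq_bigr => t _.
by rewrite big_split.
Qed.

End Network.

(** * Unnormalised expectation values as functions of the site operators *)

Section Correlation.
Variables (C : numClosedFieldType) (G : sgraph) (D : nat) (p : G -> nat).
Variables (B : {set G}) (s0 : pcfg p) (T : forall v : G, 'M[C]_(p v, #|vcfg D v|)).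
Implicit Types (v w : G) (W U : {set G}) (O : 'M[C]_#|pcfg p|).
Implicit Types (s t al be : pcfg p).

Let ops := forall v : G, 'M[C]_#|vcfg D v|.
Implicit Types X Y : ops.

Definition agree_off s t : bool := [forall v, (v \notin B) ==> (s v == t v)].

Definition site_ops X al be : ops := fun v =>
  if v \in B then (T v)^t* *m delta_mx (al v) (be v) *m T v else X v.

(* [al] and [be] are pinned to [s0] off [B], so that they run over the physical
   configurations of [B]; off [B] the matrices [X v] replace [(T v)^t* *m T v]. *)
Definition correlator X O : C :=
  \sum_(al | agree_off al s0) \sum_(be | agree_off be s0)
     O (enum_rank al) (enum_rank be) * netval (site_ops X al be).

Lemma correlator_linear X X1 X2 a v O : v \notin B ->
  (forall w, w != v -> X w = X1 w /\ X w = X2 w) ->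
  X v = a *: X1 v + X2 v -> correlator X O = a * correlator X1 O + correlator X2 O.
Proof.
move=> vB e ev; rewrite mulr_sumr -big_split; apply: eq_bigr => al _ /=.
rewrite mulr_sumr -big_split; apply: eq_bigr => be _ /=.
rewrite (@netval_linear _ _ _ (site_ops X al be) (site_ops X1 al be)
  (site_ops X2 al be) a v); first by rewrite mulrDr mulrCA.
  by move=> w wv; rewrite /site_ops; case: ifP => // _; apply: e.
by rewrite /site_ops (negPf vB).
Qed.

(** A bound of one on the numerical radius, which is what a sum of vector expectations calls for. *)
Definition contraction O := forall f : pcfg p -> C,
  `|\sum_s \sum_t (f s)^* * O (enum_rank s) (enum_rank t) * f t|
    <= \sum_s `|f s| ^+ 2.

(** Off [B] each [X v] is a Gram matrix, so the network is an inner product of amplitudes and the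
    correlator a sum of vector expectations of [O]. *)
Lemma correlator_gram X (d0 : 'I_D) : (forall v, v \notin B -> psdmx (X v)) ->
  exists (K : finType) (f : K -> pcfg p -> C), forall O,
    correlator X O = \sum_k \sum_s \sum_t
                 (f k s)^* * O (enum_rank s) (enum_rank t) * f k t.
Proof.
move=> hX.
have h v : exists a : 'M[C]_#|vcfg D v|, (v \notin B) ==> (X v == a^t* *m a).
  have [|vB] := boolP (v \in B); first by exists 0; rewrite implyFb.
  by have [a ->] := psd_factor (hX v vB); exists a; rewrite eqxx.
pose a v := xchoose (h v).
have ha v : v \notin B -> X v = (a v)^t* *m a v.
  by move=> vB; have /implyP/(_ vB)/eqP := xchooseP (h v).
(* A fixed virtual basis vector: the matrix units through [k0 v] multiply to
   [delta_mx (al v) (be v)], so that one factor depends on [al] alone and the other on [be]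
   alone. *)
pose k0 v : 'I_#|vcfg D v| := enum_rank [ffun=> d0].
pose A al v : 'M[C]_#|vcfg D v| :=
  if v \in B then delta_mx (k0 v) (al v) *m T v else a v.
exists {dffun forall v : G, 'I_#|vcfg D v|}.
exists (fun k s => if agree_off s s0 then amp (A s) k else 0) => O.
under [RHS]eq_bigr => k _.
  rewrite (bigID (agree_off^~ s0)) /= [X in _ + X]big1 ?addr0; last first.
    move=> s /negPf->; apply: big1 => t _; by rewrite conjC0 !mul0r.
  under eq_bigr => s hs.
    rewrite (bigID (agree_off^~ s0)) /= [X in _ + X]big1 ?addr0; last first.
      by move=> t /negPf->; rewrite mulr0.
    rewrite hs; under eq_bigr => t ht do rewrite ht -mulrA mulrCA.
    over.
  over.
rewrite [RHS]exchange_big; apply: eq_bigr => al _ /=.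
rewrite [RHS]exchange_big; apply: eq_bigr => be _ /=.
rewrite -mulr_sumr -netval_amp; congr (_ * _); apply: eq_netval => v.
rewrite /site_ops /A; case: ifPn => [_|/ha //].
rewrite adjmxM trmx_delta map_delta_mx -!mulmxA.
by rewrite (mulmxA (delta_mx (al v) (k0 v))) mul_delta_mx.
Qed.

Lemma correlator_le X (d0 : 'I_D) O : (forall v, v \notin B -> psdmx (X v)) ->
  contraction O -> `|correlator X O| <= correlator X 1%:M.
Proof.
move=> /(correlator_gram d0)[K [f e]] hO; rewrite !e.
apply: le_trans (ler_norm_sum _ _ _) _; apply: ler_sum => k _.
apply: le_trans (hO (f k)) _; apply: ler_sum => s _.
rewrite (bigD1 s) //= mxE eqxx mulr1 big1 ?addr0 => [|t ts].
  by rewrite mulrC -normCK.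
by rewrite mxE (inj_eq enum_rank_inj) eq_sym (negPf ts) mulr0 mul0r.
Qed.

(** The zero observable is a contraction, and its bound is the nonnegativity. *)
Lemma correlator1_ge0 X (d0 : 'I_D) : (forall v, v \notin B -> psdmx (X v)) ->
  0 <= correlator X 1%:M.
Proof.
move=> hX; have /(correlator_le d0 hX) : contraction 0 => [f|].
  rewrite big1 ?normr0 => [|s _]; first by apply: sumr_ge0 => s _; rewrite exprn_ge0.
  by apply: big1 => t _; rewrite mxE mulr0 mul0r.
exact/le_trans/normr_ge0.
Qed.

Definition patch s : pcfg p := [ffun v => if v \in B then s v else s0 v].

Lemma agree_off_patch s : agree_off (patch s) s0.
Proof. by apply/forallP => v; apply/implyP => /negPf vB; rewrite ffunE vB. Qed.

(** Locality stated on full configurations, with the sites off [B] reset to [s0], to avoid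
    configurations of a subtype. *)
Definition is_local O := forall s t, O (enum_rank s) (enum_rank t) =
  if agree_off s t then O (enum_rank (patch s)) (enum_rank (patch t)) else 0.

Let Y al be v : 'M[C]_(p v) := if v \in B then delta_mx (al v) (be v) else 1%:M.

(** The product is a matrix unit on [B] and the identity off [B], so only [al = patch s] and
    [be = patch t] can contribute. *)
Lemma is_local_expand O s t : is_local O ->
  O (enum_rank s) (enum_rank t) =
  \sum_(al | agree_off al s0) \sum_(be | agree_off be s0)
     O (enum_rank al) (enum_rank be) * \prod_v Y al be v (s v) (t v).
Proof.
move=> hO.
have neq_patch (al : pcfg p) u : agree_off al s0 -> al != patch u ->
    exists2 v, v \in B & al v != u v.
  move=> /forallP ha ne.
  have /existsP[v hv] : [exists v, al v != patch u v].
    apply: contraNT ne => /existsPn h; apply/eqP/ffunP => v.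
    by apply/eqP; rewrite -[_ == _]negbK h.
  exists v; last first.
    by move: hv; rewrite ffunE; case: ifPn => // vB; rewrite (implyP (ha v)).
  apply: contraNT hv => vB; rewrite ffunE (negPf vB); exact: (implyP (ha v)).
rewrite (bigD1 (patch s)) ?agree_off_patch //=.
rewrite (bigD1 (patch t)) ?agree_off_patch //=.
rewrite [X in _ + X + _]big1 ?addr0; last first.
  move=> be /andP[hb ne]; have [v vB hv] := neq_patch _ _ hb ne.
  by rewrite (bigD1 v) //= /Y vB mxE [t v == _]eq_sym (negPf hv) andbF mul0r mulr0.
rewrite [X in _ + X]big1 ?addr0; last first.
  move=> al /andP[ha ne]; apply: big1 => be _.
  have [v vB hv] := neq_patch _ _ ha ne.
  by rewrite (bigD1 v) //= /Y vB mxE [s v == _]eq_sym (negPf hv) mul0r mulr0.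
rewrite hO; case: ifPn => [/forallP h|].
  rewrite big1 ?mulr1 // => v _; rewrite /Y; case: ifPn => [vB|/(implyP (h v)) e].
    by rewrite mxE !ffunE vB !eqxx.
  by rewrite mxE e.
rewrite negb_forall => /existsP[v]; rewrite negb_imply => /andP[/negPf vB ne].
by rewrite (bigD1 v) //= /Y vB mxE (negPf ne) mul0r mulr0.
Qed.

Lemma correlator_expect O : is_local O ->
  \sum_(s : pcfg p) \sum_(t : pcfg p) (amp T s)^* * O (enum_rank s) (enum_rank t) * amp T t =
  correlator (fun v => (T v)^t* *m T v) O.
Proof.
move=> hO.
transitivity (\sum_(s : pcfg p) \sum_(t : pcfg p)
   \sum_(al | agree_off al s0) \sum_(be | agree_off be s0)
   O (enum_rank al) (enum_rank be) *
     ((amp T s)^* * (\prod_v Y al be v (s v) (t v) * amp T t))).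
  apply: eq_bigr => s _; apply: eq_bigr => t _.
  rewrite (is_local_expand s t hO) -mulrA mulr_suml mulr_sumr.
  apply: eq_bigr => al _; rewrite mulr_suml mulr_sumr.
  by apply: eq_bigr => be _; rewrite -[O _ _ * _ * _]mulrA mulrCA.
under eq_bigr do rewrite exchange_big.
rewrite exchange_big; apply: eq_bigr => al _ /=.
under eq_bigr do rewrite exchange_big.
rewrite exchange_big; apply: eq_bigr => be _ /=.
under eq_bigr do rewrite -mulr_sumr -mulr_sumr -amp_mul.
rewrite -mulr_sumr -netval_amp; congr (_ * _); apply: eq_netval => v.
by rewrite /site_ops /Y; case: ifP => _; rewrite ?mul1mx ?mulmxA.
Qed.

End Correlation.

(** * Decay of correlations *)

Lemma sum_predU_le (R : numDomainType) (I : finType) (P Q : pred I) (f : I -> R) :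
  (forall i, 0 <= f i) ->
  \sum_(i | P i || Q i) f i <= \sum_(i | P i) f i + \sum_(i | Q i) f i.
Proof.
move=> f0; rewrite !(big_mkcond _ f) -big_split; apply: ler_sum => i _ /=.
by case: (P i); case: (Q i); rewrite ?addr0 ?add0r ?lerDl.
Qed.

(* [P] and [F] are the norms of the identity and the remainder branch at the
   expanded vertex, [h - g] and [h - g + S] the potentials after the two outcomes. *)
Lemma four_way_bound (R : numDomainType) (P F P' F' h g S e z0 z1 z2 z3 : R) :
  0 <= P -> 0 <= F -> 0 <= P' -> 0 <= F' -> 0 <= S ->
  F <= e * (P + F) -> F' <= e * (P' + F') -> 2 * e * S <= g ->
  z0 <= (h - g) * (P * P') -> z1 <= (h - g + S) * (P * F') ->
  z2 <= (h - g + S) * (F * P') -> z3 <= (h - g + S) * (F * F') ->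
  z0 + z1 + z2 + z3 <= h * ((P + F) * (P' + F')).
Proof.
move=> P0 F0 P'0 F'0 S0 hF hF' hg h0 h1 h2 h3.
apply: le_trans (lerD (lerD (lerD h0 h1) h2) h3) _; rewrite -subr_ge0.
(* The weight away from P P' is F' (P + F) + F (P' + F') - F F', at most 2 e times the total. *)
have -> : h * ((P + F) * (P' + F')) -
  ((h - g) * (P * P') + (h - g + S) * (P * F') + (h - g + S) * (F * P') +
    (h - g + S) * (F * F')) =
  (g - 2 * e * S) * ((P + F) * (P' + F')) +
  S * ((P + F) * (e * (P' + F') - F') + (P' + F') * (e * (P + F) - F) + F * F').
  by ring.
have PF : 0 <= P + F by exact: addr_ge0.
have PF' : 0 <= P' + F' by exact: addr_ge0.
apply: addr_ge0; apply: mulr_ge0; rewrite ?subr_ge0 ?mulr_ge0 //.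
by apply: addr_ge0; rewrite ?mulr_ge0 //; apply: addr_ge0; rewrite mulr_ge0 ?subr_ge0.
Qed.

Lemma mul_sum4 (R : pzRingType) (I : finType) (P : pred I) (f g : I -> I -> R) :
  (\sum_(i | P i) \sum_(j | P j) f i j) * (\sum_(i | P i) \sum_(j | P j) g i j) =
  \sum_(i | P i) \sum_(j | P j) \sum_(k | P k) \sum_(l | P l) f i j * g k l.
Proof.
rewrite mulr_suml; apply: eq_bigr => i _; rewrite mulr_suml.
apply: eq_bigr => j _; rewrite mulr_sumr; apply: eq_bigr => k _.
by rewrite mulr_sumr.
Qed.

Section Decay.
Variables (C : numClosedFieldType) (G : sgraph) (D : nat) (p : G -> nat).
Variables (B : {set G}) (s0 : pcfg p) (T : forall v : G, 'M[C]_(p v, #|vcfg D v|)).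
Implicit Types (v w u : G) (W U : {set G}).
Let ops := forall v : G, 'M[C]_#|vcfg D v|.
Implicit Types X Y : ops.
Local Notation corr := (correlator B s0 T).

(** At fixed indices on [B] the network exchange over [W] applies, since [W] avoids [B] and is
    surrounded by identities. *)
Lemma correlator_exchange W X X' (O O' : 'M[C]_#|pcfg p|) :
  [disjoint W & B] ->
  (forall v, v \notin W -> v \notin B -> X v = X' v) ->
  (forall w v, w \in W -> v \notin W -> adj w v ->
     v \notin B /\ X v = 1%:M) ->
  corr X O * corr X' O' = corr X' O * corr X O'.
Proof.
move=> WB hX h1; rewrite /correlator.
have nB v : v \in W -> v \in B = false by move/(disjointFr WB).
rewrite !mul_sum4; do 4! [apply: eq_bigr => ? _].
rewrite mulrACA [RHS]mulrACA.
congr (_ * _); apply: (@netval_exchange _ _ _ W).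
- by move=> v /nB e; rewrite /site_ops e.
- by move=> v vW; rewrite /site_ops; case: ifPn => // vB; rewrite hX.
- move=> v n vW nW; have [|/negPf vB e] := h1 _ v nW vW; last first.
    by rewrite /site_ops vB e.
  by rewrite adj_sym (valP n).
Qed.

(** The norm is linear in the operator at [v] and nonnegative on positive families, hence monotone
    there. *)
Lemma correlator_site_le (d0 : 'I_D) XI XF v eps : v \notin B ->
  (forall u, u != v -> XF u = XI u) -> XI v = 1%:M ->
  psdmx (eps%:M - XF v) -> (forall u, u \notin B -> psdmx (XI u)) ->
  corr XF 1%:M <= eps * corr XI 1%:M.
Proof.
move=> vB e e1 hF hI.
pose fam (M : 'M[C]_#|vcfg D v|) : ops := dfwith XI M.
have fam_out M u : u != v -> fam M u = XI u.
  by move=> uv; rewrite /fam dfwith_out // eq_sym.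
have lin (M N : 'M[C]_#|vcfg D v|) a :
    corr (fam (a *: M + N)) 1%:M = a * corr (fam M) 1%:M + corr (fam N) 1%:M.
  apply: (@correlator_linear _ _ _ _ _ _ _ _ (fam M) (fam N) a v) => //.
    by move=> u uv; rewrite !fam_out.
  by rewrite /fam !dfwith_in.
have ext (Z Z' : ops) : (forall u, Z u = Z' u) -> corr Z 1%:M = corr Z' 1%:M.
  move=> zz; rewrite /correlator; do 2! [apply: eq_bigr => ? _].
  by congr (_ * _); apply: eq_netval => u; rewrite /site_ops zz.
have -> : corr XF 1%:M = corr (fam (XF v)) 1%:M.
  apply: ext => u; have [->|uv] := eqVneq u v; first by rewrite /fam dfwith_in.
  by rewrite fam_out // e.
have -> : corr XI 1%:M = corr (fam 1%:M) 1%:M.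
  apply: ext => u; have [->|uv] := eqVneq u v; first by rewrite /fam dfwith_in.
  by rewrite fam_out.
have z0 : corr (fam 0) 1%:M = 0.
  by have := lin 0 0 (-1); rewrite scaler0 addr0 mulN1r addNr.
have := lin (XF v) (eps *: 1%:M) (-1); have := lin 1%:M 0 eps.
rewrite addr0 z0 addr0 scaleN1r mulN1r => -> h.
rewrite -subr_ge0 addrC -h; apply: (correlator1_ge0 _ _ d0) => u uB.
have [->|uv] := eqVneq u v; last by rewrite fam_out //; apply: hI.
by rewrite /fam dfwith_in addrC scalemx1.
Qed.

Variables (E : ops) (O : 'M[C]_#|pcfg p|) (eps : C) (gam : G -> C) (d0 : 'I_D).
Hypothesis O_contr : contraction O.
Hypothesis eps_le1 : eps <= 1.
Hypothesis gam_ge0 : forall v, 0 <= gam v.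
Hypothesis gam_B : forall v, v \in B -> 2 <= gam v.
Hypothesis gam_step : forall v w, adj v w ->
  2 * eps * \sum_(u | adj v u && (u != w)) gam u <= gam v.

(** The potential when [W] carries the discrepancy and [U] is still to be expanded; the sites of [B]
    stay charged throughout. *)
Definition boundary W U : C :=
  \sum_(u | (u \in U :|: B) && [exists w in W, adj w u]) gam u.

Lemma boundary_ge0 W U : 0 <= boundary W U.
Proof. by apply: sumr_ge0. Qed.

Lemma boundaryD1 W U v w : [disjoint U & B] -> v \in U -> w \in W -> adj w v ->
  boundary W (U :\ v) = boundary W U - gam v.
Proof.
move=> UB vU wW wv; have vB := disjointFr UB vU.
rewrite /boundary [X in _ = X - _](bigD1 v) /=; last first.
  by rewrite inE vU /=; apply/existsP; exists w; rewrite wW.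
rewrite [RHS]addrC addKr; apply: eq_bigl => u; rewrite !inE.
have [->|_] := eqVneq u v; first by rewrite vB !andbF.
by rewrite !andbT.
Qed.

(** Once [v] joins [W], the new boundary vertices are neighbours of [v]; [w] is not among them, as
    it lies in [W], hence outside [U] and [B]. *)
Lemma boundaryU1 W U v w : [disjoint W & B] -> [disjoint W & U] ->
  [disjoint U & B] -> v \in U -> w \in W -> adj w v ->
  boundary (v |: W) (U :\ v) <=
    boundary W U - gam v + \sum_(u | adj v u && (u != w)) gam u.
Proof.
move=> WB WU UB vU wW wv; rewrite -(boundaryD1 UB vU wW wv).
apply: le_trans (sum_predU_le _ _ gam_ge0).
rewrite /boundary [leLHS]big_mkcond [leRHS]big_mkcond; apply: ler_sum => u _.
case: ifP => [/andP[hu /existsP[x /andP[]]]|_]; last by case: ifP.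
rewrite in_setU1 => /orP[/eqP->|xW] xu; last first.
  by rewrite hu (_ : [exists _ in _, _]) //; apply/existsP; exists x; rewrite xW.
rewrite xu (_ : u != w) ?orbT //; apply: contraTneq hu => ->.
by rewrite !inE (disjointFr WB wW) (disjointFr WU wW) andbF.
Qed.

(** Induction on the number of unexpanded vertices. Off [B], the families differ at most on [W],
    equal [E] on [U] and are the identity elsewhere; cross-multiplying avoids expanding a
    quotient. *)
Lemma correlator_decay n W U X X' : #|U| = n ->
  [disjoint W & B] -> [disjoint W & U] -> [disjoint U & B] ->
  (forall v, v \notin W -> v \notin B -> X v = X' v) ->
  (forall v, v \in U -> X v = E v) ->
  (forall v, v \notin W -> v \notin U -> v \notin B -> X v = 1%:M) ->
  (forall v, v \in U -> psdmx (E v - (1 - eps)%:M)) ->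
  (forall v, v \in U -> psdmx (1%:M - E v)) ->
  (forall v, v \notin B -> psdmx (X v)) -> (forall v, v \notin B -> psdmx (X' v)) ->
  `|corr X O * corr X' 1%:M - corr X' O * corr X 1%:M|
    <= boundary W U * (corr X 1%:M * corr X' 1%:M).
Proof.
elim: n W U X X' => [|n IHn] W U X X' cU WB WU UB XX' XE X1 Ege Ele Xp X'p.
all: have N0 := correlator1_ge0 s0 T d0 Xp; have N'0 := correlator1_ge0 s0 T d0 X'p.
all: have [/exists_inP[w wW /existsP[u /andP[wu uB]]]|nWB] :=
  boolP [exists w in W, [exists u, adj w u && (u \in B)]].
(* If [W] touches [B], the potential is at least 2, and the trivial bound on the two products
   suffices. *)
1,3: have h2 : 2 <= boundary W U by
  rewrite /boundary (bigD1 u) /= ?inE ?uB ?orbT /=;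
   [apply: le_trans (gam_B uB) _; rewrite lerDl sumr_ge0
   |apply/existsP; exists w; rewrite wW].
1,2: apply: (@le_trans _ _ (2 * (corr X 1%:M * corr X' 1%:M)));
  [|by apply: ler_wpM2r => //; apply: mulr_ge0];
  rewrite mulr_natl mulr2n; apply: le_trans (ler_normB _ _) _; rewrite !normrM;
  rewrite (ger0_norm N0) (ger0_norm N'0) [X in _ <= _ + X]mulrC;
  apply: lerD; apply: ler_wpM2r => //; exact: correlator_le.
all: have WnB w v : w \in W -> adj w v -> v \notin B by
  move=> wW wv; apply: contraNN nWB => vB; apply/exists_inP; exists w => //;
  apply/existsP; exists v; rewrite wv.
  have U0 : U = set0 by apply/eqP; rewrite -cards_eq0 cU.
  (* Nothing is left to expand: all neighbours of [W] carry the identity, and the exchange makes the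
     two products equal. *)
  rewrite (@correlator_exchange W X X') ?subrr ?normr0 ?mulr_ge0 ?boundary_ge0 //.
  move=> w v wW vW wv; have vB := WnB w v wW wv; split=> //.
  by apply: X1; rewrite // U0 inE.
have [/exists_inP[w wW /existsP[v /andP[wv vU]]]|nWU] :=
  boolP [exists w in W, [exists u, adj w u && (u \in U)]]; last first.
  rewrite (@correlator_exchange W X X') ?subrr ?normr0 ?mulr_ge0 ?boundary_ge0 //.
  move=> w v wW vW wv; have vB := WnB w v wW wv; split=> //.
  apply: X1 => //; apply: contraNN nWU => vU; apply/exists_inP; exists w => //.
  by apply/existsP; exists v; rewrite wv.
have vB : v \notin B by rewrite (disjointFr UB vU).
have vW : v \notin W by rewrite (disjointFl WU vU).
(* Both networks are expanded at [v], as [1 - eps] times the identity plus [F]; [XI] and [XF] are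
   the two outcomes. *)
pose F := E v - (1 - eps)%:M.
pose XI : ops := dfwith X (1%:M : 'M[C]_#|vcfg D v|).
pose XF : ops := dfwith X F.
pose XI' : ops := dfwith X' (1%:M : 'M[C]_#|vcfg D v|).
pose XF' : ops := dfwith X' F.
have oI u : u != v -> XI u = X u by move=> uv; rewrite /XI dfwith_out // eq_sym.
have oF u : u != v -> XF u = X u by move=> uv; rewrite /XF dfwith_out // eq_sym.
have oI' u : u != v -> XI' u = X' u by move=> uv; rewrite /XI' dfwith_out // eq_sym.
have oF' u : u != v -> XF' u = X' u by move=> uv; rewrite /XF' dfwith_out // eq_sym.
have F_psd : psdmx F by exact: Ege.
have G_psd : psdmx (1%:M - E v) by exact: Ele.
have pd (Z Z' : ops) : (forall u, u != v -> Z' u = Z u) -> psdmx (Z' v) ->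
    (forall u, u \notin B -> psdmx (Z u)) -> forall u, u \notin B -> psdmx (Z' u).
  by move=> e hv hZ u uB; have [->|/e->] := eqVneq u v => //; apply: hZ.
have XIp : forall u, u \notin B -> psdmx (XI u).
  by apply: pd oI _ Xp; rewrite /XI dfwith_in; apply: psd1.
have XI'p : forall u, u \notin B -> psdmx (XI' u).
  by apply: pd oI' _ X'p; rewrite /XI' dfwith_in; apply: psd1.
have XFp : forall u, u \notin B -> psdmx (XF u).
  by apply: pd oF _ Xp; rewrite /XF dfwith_in.
have XF'p : forall u, u \notin B -> psdmx (XF' u).
  by apply: pd oF' _ X'p; rewrite /XF' dfwith_in.
have EvF : E v = (1 - eps) *: 1%:M + F by rewrite scalemx1 addrC subrK.
have dec O0 : corr X O0 = (1 - eps) * corr XI O0 + corr XF O0.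
  apply: (@correlator_linear _ _ _ _ _ _ _ _ _ _ _ v) => //.
    by move=> u uv; rewrite oI // oF.
  by rewrite /XI /XF !dfwith_in XE.
have dec' O0 : corr X' O0 = (1 - eps) * corr XI' O0 + corr XF' O0.
  apply: (@correlator_linear _ _ _ _ _ _ _ _ _ _ _ v) => //.
    by move=> u uv; rewrite oI' // oF'.
  by rewrite /XI' /XF' !dfwith_in -XX' // XE.
have eG : eps%:M - F = 1%:M - E v.
  by rewrite /F opprB addrA -raddfD /= [eps + _]addrC subrK.
have F_le : corr XF 1%:M <= eps * corr XI 1%:M.
  apply: (@correlator_site_le d0 XI XF v) => //.
  - by move=> u uv; rewrite oI ?oF.
  - by rewrite /XI dfwith_in.
  - by rewrite /XF dfwith_in eG.
have F'_le : corr XF' 1%:M <= eps * corr XI' 1%:M.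
  apply: (@correlator_site_le d0 XI' XF' v) => //.
  - by move=> u uv; rewrite oI' ?oF'.
  - by rewrite /XI' dfwith_in.
  - by rewrite /XF' dfwith_in eG.
have nI0 := correlator1_ge0 s0 T d0 XIp; have nF0 := correlator1_ge0 s0 T d0 XFp.
have nI'0 := correlator1_ge0 s0 T d0 XI'p; have nF'0 := correlator1_ge0 s0 T d0 XF'p.
have e1 : 0 <= 1 - eps by rewrite subr_ge0.
have cU' : #|U :\ v| = n by move: cU; rewrite (cardsD1 v) vU => -[].
have WU' : [disjoint W & U :\ v] by apply: disjointWr WU; apply: subsetDl.
have UB' : [disjoint U :\ v & B] by apply: disjointWl UB; apply: subsetDl.
have WB1 : [disjoint v |: W & B].
  by rewrite disjoints_subset subUset sub1set inE vB -disjoints_subset.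
have WU1 : [disjoint v |: W & U :\ v].
  by rewrite disjoints_subset subUset sub1set !inE eqxx -disjoints_subset.
have gW := gam_step (etrans (adj_sym v w) wv).
have S0 : 0 <= \sum_(u | adj v u && (u != w)) gam u by apply: sumr_ge0.
have hD := boundaryD1 UB vU wW wv; have hU := boundaryU1 WB WU UB vU wW wv.
have eU u : u \in U :\ v -> E u = E u /\ u \in U by rewrite !inE => /andP[].
(* The induction hypothesis for any pair of outcomes: [W1] is [W] if both are the identity;
   otherwise it also contains [v], where some operator is now [F]. *)
have step W1 (Z Z' : ops) : [disjoint W1 & B] -> [disjoint W1 & U :\ v] ->
    W \subset W1 ->
    (forall u, u != v -> Z u = X u) -> (forall u, u != v -> Z' u = X' u) ->
    (v \notin W1 -> Z v = 1%:M /\ Z' v = 1%:M) ->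
    (forall u, u \notin B -> psdmx (Z u)) -> (forall u, u \notin B -> psdmx (Z' u)) ->
    `|corr Z O * corr Z' 1%:M - corr Z' O * corr Z 1%:M|
      <= boundary W1 (U :\ v) * (corr Z 1%:M * corr Z' 1%:M).
  move=> dB dU sW oZ oZ' zv Zp Z'p; apply: IHn => //.
  - move=> u uW1 uB; have [uv|uv] := eqVneq u v.
      by move: uW1; rewrite uv => /zv[-> ->].
    rewrite oZ // oZ' // XX' //; exact: contraNN (subsetP sW u) uW1.
  - by move=> u; rewrite !inE => /andP[uv uU]; rewrite oZ // XE.
  - move=> u uW1 uU uB; have [uv|uv] := eqVneq u v.
      by move: uW1; rewrite uv => /zv[].
    rewrite oZ //; apply: X1 => //; first exact: contraNN (subsetP sW u) uW1.
    by apply: contraNN uU => uU; rewrite !inE uv.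
  - by move=> u; rewrite !inE => /andP[_ uU]; apply: Ege.
  - by move=> u; rewrite !inE => /andP[_ uU]; apply: Ele.
have sWv : W \subset v |: W by exact: subsetUr.
have vN (P : Prop) : v \notin v |: W -> P by rewrite setU11.
have b0 := step W _ _ WB WU' (subxx _) oI oI' _ XIp XI'p.
have b1 := step _ _ _ WB1 WU1 sWv oI oF' (vN _) XIp XF'p.
have b2 := step _ _ _ WB1 WU1 sWv oF oI' (vN _) XFp XI'p.
have b3 := step _ _ _ WB1 WU1 sWv oF oF' (vN _) XFp XF'p.
have {}b0 := b0 (fun _ => conj (dfwith_in _ _) (dfwith_in _ _)).
(* Multiplying the bound by [1 - eps] compares the remainder with the whole expanded norm. *)
have F_e : corr XF 1%:M <= eps * ((1 - eps) * corr XI 1%:M + corr XF 1%:M).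
  rewrite mulrDr mulrCA -lerBlDr -{1}[corr XF _]mul1r -mulrBl.
  exact: ler_wpM2l.
have F'_e : corr XF' 1%:M <= eps * ((1 - eps) * corr XI' 1%:M + corr XF' 1%:M).
  rewrite mulrDr mulrCA -lerBlDr -{1}[corr XF' _]mul1r -mulrBl.
  exact: ler_wpM2l.
(* Restores the weights [1 - eps] of the identity outcomes, which scale both sides equally. *)
have nb (a b c d x y H : C) : 0 <= x -> 0 <= y -> 0 <= c -> 0 <= d ->
    `|a * d - b * c| <= H * (c * d) ->
    `|(x * a) * (y * d) - (y * b) * (x * c)| <= H * ((x * c) * (y * d)).
  move=> x0 y0 c0 d0' h.
  have -> : x * a * (y * d) - y * b * (x * c) = x * y * (a * d - b * c) by ring.
  have -> : H * (x * c * (y * d)) = x * y * (H * (c * d)) by ring.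
  by rewrite normrM ger0_norm ?mulr_ge0 // ler_wpM2l ?mulr_ge0.
have {}b0 := nb _ _ _ _ _ _ _ e1 e1 nI0 nI'0 b0.
have {}b1 := nb _ _ _ _ _ _ _ e1 ler01 nI0 nF'0 b1.
have {}b2 := nb _ _ _ _ _ _ _ ler01 e1 nF0 nI'0 b2.
rewrite hD in b0; rewrite !mul1r in b1 b2.
have up (x c d : C) : 0 <= c -> 0 <= d ->
    x <= boundary (v |: W) (U :\ v) * (c * d) ->
    x <= (boundary W U - gam v + \sum_(u | adj v u && (u != w)) gam u) * (c * d).
  by move=> c0 d0' h; apply: le_trans h _; apply: ler_wpM2r => //; apply: mulr_ge0.
have {}b1 := up _ _ _ (mulr_ge0 e1 nI0) nF'0 b1.
have {}b2 := up _ _ _ nF0 (mulr_ge0 e1 nI'0) b2.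
have {}b3 := up _ _ _ nF0 nF'0 b3.
rewrite !dec !dec'.
apply: le_trans (four_way_bound (mulr_ge0 e1 nI0) nF0 (mulr_ge0 e1 nI'0) nF'0 S0
  F_e F'_e gW b0 b1 b2 b3).
set aI := corr XI O; set aF := corr XF O; set aI' := corr XI' O.
set aF' := corr XF' O; set iI := corr XI _; set iF := corr XF _.
set iI' := corr XI' _; set iF' := corr XF' _.
rewrite [X in `|X| <= _](_ : _ =
  ((1 - eps) * aI * ((1 - eps) * iI') - (1 - eps) * aI' * ((1 - eps) * iI)) +
  ((1 - eps) * aI * iF' - aF' * ((1 - eps) * iI)) +
  (aF * ((1 - eps) * iI') - (1 - eps) * aI' * iF) +
  (aF * iF' - aF' * iF)); last by ring.
by do 3! [apply: le_trans (ler_normD _ _) _; apply: lerD => //].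
Qed.

End Decay.

(** * Truncated graph distance *)

Section Reach.
Variables (G : sgraph) (B : {set G}).

Definition reach (k : nat) : {set G} :=
  iter k (fun S => S :|: [set u | [exists w in S, adj w u]]) B.

Lemma reachS k u : (u \in reach k.+1) =
  (u \in reach k) || [exists w in reach k, adj w u].
Proof. by rewrite /= !inE. Qed.

Lemma reach0 k u : u \in B -> u \in reach k.
Proof. by move=> uB; elim: k => // k IH; rewrite reachS IH. Qed.

Lemma reach_walk k u : u \in reach k ->
  exists w j, [/\ w \in B, (j <= k)%N & walk w u j].
Proof.
elim: k u => [|k IH] u; first by move=> uB; exists u, 0%N; split=> //; exists [::].
rewrite reachS => /orP[/IH[w [j [wB jk h]]]|].
  by exists w, j; split=> //; apply: leqW.
case/exists_inP => x /IH[w [j [wB jk [s [ps ls sj]]]]] xu.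
exists w, j.+1; split=> //; exists (rcons s u).
by rewrite rcons_path ps ls xu last_rcons size_rcons sj.
Qed.

(* The distance from [u] to [B], truncated at [r]. *)
Definition tdist (r : nat) (u : G) : nat := \sum_(k < r) (u \notin reach k).

Lemma tdist_in r u : u \in B -> tdist r u = 0%N.
Proof. by move=> uB; rewrite /tdist big1 // => k _; rewrite reach0. Qed.

(** A neighbour of [reach k] lies in [reach k.+1], so the sums compare after an index shift, the
    first term giving the extra one. *)
Lemma tdist_adj r u v : adj u v -> (tdist r v <= (tdist r u).+1)%N.
Proof.
move=> uv; case: r => [|r]; first by rewrite /tdist big_ord0.
rewrite /tdist big_ord_recl [in leqRHS]big_ord_recr /= -add1n.
apply: leq_add; first by case: (_ \notin _).
apply: leq_trans (leq_addr _ _); apply: leq_sum => k _.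
case: (boolP (u \in reach k)) => [uk|_]; last by case: (_ \notin _).
by rewrite (_ : v \in _) // reachS; apply/orP; right; apply/exists_inP; exists u.
Qed.

(** A walk from [B] to [u] of length less than [r.-1] would extend to [w] with length less than
    [r]. *)
Lemma tdist_ge r u w : (forall x j, x \in B -> walk x w j -> (r <= j)%N) ->
  adj w u -> (r.-1 <= tdist r u)%N.
Proof.
move=> h wu; case: r h => // r h; rewrite /tdist big_ord_recr /=.
apply: leq_trans (leq_addr _ _).
rewrite (eq_bigr (fun=> 1%N)) ?sum1_card ?card_ord // => k _.
suff -> : u \notin reach k by [].
apply/negP => /reach_walk[x [j [xB jk [s [ps ls sj]]]]].
have : (r.+1 <= j.+1)%N.
  apply: h xB _; exists (rcons s w).
  by rewrite rcons_path ps ls adj_sym wu last_rcons size_rcons sj.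
by rewrite ltnS leqNgt (leq_ltn_trans jk).
Qed.

End Reach.

Lemma card_nbr (G : sgraph) (v : G) : (#|[pred u | adj v u]| <= max_degree G)%N.
Proof.
rewrite -[X in (X <= _)%N](_ : #|[set u | adj v u]| = _).
  exact: leq_bigmax.
by apply: eq_card => u; rewrite !inE.
Qed.

Lemma card_nbrD1 (G : sgraph) (v w : G) : adj v w ->
  (#|[pred u | adj v u && (u != w)]| <= (max_degree G).-1)%N.
Proof.
move=> vw; have := card_nbr v; rewrite (cardD1 w) inE vw /=.
case: (max_degree G) => // d; rewrite ltnS; apply: leq_trans.
by apply: eq_leq; apply: eq_card => u; rewrite !inE andbC.
Qed.

(** On the kernel of [E] the lower bound makes minus [c] times the Gram matrix of the kernel rows
    positive, so these rows vanish. *)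
Lemma gram_unit (C : numClosedFieldType) n (E : 'M[C]_n) (c : C) : 0 < c ->
  psdmx (E - c%:M) -> E \in unitmx.
Proof.
move=> c0 hE; rewrite -row_free_unit -kermx_eq0.
move: (kermx E) (mulmx_ker E) => K KE; have := psd_conj (K^t*) hE.
rewrite trmxCK mulmxBr KE sub0r mulNmx mul_mx_scalar -scalemxAl.
move=> hK; apply/eqP/matrixP => i j; rewrite [RHS]mxE.
have /(psd_diag i) := hK; rewrite !mxE oppr_ge0 pmulr_rle0 // => h.
have s0 : \sum_j `|K i j| ^+ 2 = 0.
  apply/eqP; rewrite eq_le sumr_ge0 ?andbT => [|k _]; last by rewrite exprn_ge0.
  apply: le_trans h; rewrite le_eqVlt; apply/orP; left; apply/eqP.
  by apply: eq_bigr => k _; rewrite adjmxE normCK.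
have /eqP : `|K i j| ^+ 2 = 0.
  by apply: (psumr_eq0P _ s0) => // k _; apply: exprn_ge0.
by rewrite expf_eq0 /= => /eqP; apply: normr0_eq0.
Qed.

(** * Norms and expectation values as quadratic forms in the amplitudes *)

Section Expectation.
Variables (C : numClosedFieldType) (G : sgraph) (D : nat) (p : G -> nat).
Implicit Types (v w u : G) (A B : {set G}).
Implicit Types (T : forall v : G, 'M[C]_(p v, #|vcfg D v|)) (O : 'M[C]_#|pcfg p|).

Definition qform T O : C :=
  \sum_(s : pcfg p) \sum_(t : pcfg p)
    (amp T s)^* * O (enum_rank s) (enum_rank t) * amp T t.

Lemma qform1 T : qform T 1%:M = \sum_(s : pcfg p) `|amp T s| ^+ 2.
Proof.
apply: eq_bigr => s _; rewrite (bigD1 s) //= mxE eqxx mulr1 big1 ?addr0 => [|t ts].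
  by rewrite mulrC -normCK.
by rewrite mxE (inj_eq enum_rank_inj) eq_sym (negPf ts) mulr0 mul0r.
Qed.

(** If the norm vanished, so would all amplitudes; but left inverses turn the tensors into
    identities, whose amplitude at a constant configuration is one. *)
Lemma qform1_gt0 T (d0 : 'I_D) (c : C) : 0 < c ->
  (forall v, psdmx ((T v)^t* *m T v - c%:M)) -> 0 < qform T 1%:M.
Proof.
move=> c0 hT; rewrite qform1 lt_neqAle sumr_ge0 ?andbT => [|s _]; last first.
  by rewrite exprn_ge0.
rewrite eq_sym; apply/eqP => s0.
have amp0 t : amp T t = 0.
  have /eqP : `|amp T t| ^+ 2 = 0.
    by apply: (psumr_eq0P _ s0) => // k _; apply: exprn_ge0.
  by rewrite expf_eq0 /= => /eqP; apply: normr0_eq0.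
pose L v := invmx ((T v)^t* *m T v) *m (T v)^t*.
have LT v : L v *m T v = 1%:M.
  by rewrite -mulmxA mulVmx // (gram_unit c0 (hT v)).
pose x0 : {dffun forall v : G, vcfg D v} := [ffun v => [ffun=> d0]].
have := amp_mul L T [ffun v => enum_rank (x0 v)].
rewrite [RHS]big1 => [|t _]; last by rewrite amp0 mulr0.
rewrite /amp (bigD1 x0) /=; last first.
  by apply/forallP => v; apply/forallP => n; rewrite !ffunE.
rewrite big1 => [|v _]; last by rewrite LT !ffunE mxE eqxx.
rewrite big1 ?addr0 => [/eqP|x /andP[_ xx0]]; first by rewrite oner_eq0.
have /existsP[v hv] : [exists v, x v != x0 v].
  apply: contraNT xx0 => /existsPn h; apply/eqP/ffunP => v.
  by apply/eqP; rewrite -[_ == _]negbK h.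
rewrite (bigD1 v) //= LT ffunE mxE (inj_eq enum_rank_inj) eq_sym (negPf hv).
by rewrite mul0r.
Qed.

(** The inequality 2 |x| |Ox| <= |x|^2 + |Ox|^2, entry by entry, replaces Cauchy-Schwarz. *)
Lemma contraction_gram O : psdmx (1%:M - O^t* *m O) -> contraction O.
Proof.
move=> hO f.
pose x : 'cV[C]_#|pcfg p| := \col_i f (enum_val i).
have xE s : x (enum_rank s) 0 = f s by rewrite mxE enum_rankK.
have ex : (x^t* *m x) 0 0 = \sum_s `|f s| ^+ 2.
  by rewrite sqnormE -(sum_enum_val (I := pcfg p)); apply: eq_bigr => i _; rewrite mxE.
have le2 : ((O *m x)^t* *m (O *m x)) 0 0 <= (x^t* *m x) 0 0.
  rewrite -subr_ge0; have := hO x.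
  by rewrite mulmxBr mulmxBl mulmx1 adjmxM !mulmxA !mxE.
rewrite -ex.
have -> : \sum_s \sum_t (f s)^* * O (enum_rank s) (enum_rank t) * f t =
    \sum_i (x i 0)^* * (O *m x) i 0.
  rewrite -(sum_enum_val (I := pcfg p)); apply: eq_bigr => i _.
  rewrite [(O *m x) i 0]mxE mulr_sumr -(sum_enum_val (I := pcfg p)).
  by apply: eq_bigr => j _; rewrite !enum_valK !mxE mulrA.
apply: le_trans (ler_norm_sum _ _ _) _.
rewrite -(ler_pM2l (ltr0n C 2)) mulr_sumr.
apply: (@le_trans _ _ ((x^t* *m x) 0 0 + ((O *m x)^t* *m (O *m x)) 0 0)); last first.
  by rewrite mulr_natl mulr2n lerD2l.
rewrite !sqnormE -big_split; apply: ler_sum => i _ /=.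
rewrite normrM norm_conjC -subr_ge0.
have -> : `|x i 0| ^+ 2 + `|(O *m x) i 0| ^+ 2 - 2 * (`|x i 0| * `|(O *m x) i 0|) =
  (`|x i 0| - `|(O *m x) i 0|) ^+ 2 by ring.
by rewrite real_exprn_even_ge0 // realB // normr_real.
Qed.

Lemma qform_le T O : contraction O -> `|qform T O| <= qform T 1%:M.
Proof. by move=> hO; rewrite qform1; apply: hO. Qed.

Lemma is_local1 B (s0 : pcfg p) : is_local B s0 (1%:M : 'M[C]_#|pcfg p|).
Proof.
move=> s t; rewrite !mxE !(inj_eq enum_rank_inj).
case: ifPn => [/forallP h|h]; last first.
  by case: eqVneq h => // ->; case/negP; apply/forallP => v; rewrite eqxx implybT.
congr ((nat_of_bool _)%:R); apply/eqP/eqP => [-> //|/ffunP e]; apply/ffunP => v.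
have := e v; rewrite !ffunE; case: ifPn => // vB _.
exact/eqP/(implyP (h v)).
Qed.

(** * Change of expectation values under a local perturbation *)

Section Perturbation.
Variables (T T' : forall v : G, 'M[C]_(p v, #|vcfg D v|)) (A B : {set G}).
Variables (O : 'M[C]_#|pcfg p|) (s0 : pcfg p) (d0 : 'I_D) (eps theta : C) (r : nat).
Hypothesis eps_gt0 : 0 < eps.
Hypothesis theta_le1 : theta <= 1.
Hypothesis eps_theta : 2 * eps * (max_degree G).-1%:R <= theta.
Hypotheses (theta_gt0 : 0 < theta) (eps_le1 : eps <= 1).
Hypothesis T_ge : forall v, psdmx ((T v)^t* *m T v - (1 - eps)%:M).
Hypothesis T_le : forall v, psdmx (1%:M - (T v)^t* *m T v).
Hypothesis TT' : forall v, v \notin A -> T' v = T v.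
Hypothesis O_contr : contraction O.
Hypothesis O_local : is_local B s0 O.
Hypothesis dAB : forall x w j, x \in B -> w \in A -> walk x w j -> (r < j)%N.
Hypotheses (N_gt0 : 0 < qform T 1%:M) (N'_gt0 : 0 < qform T' 1%:M).

(** The 2 meets the trivial bound at [B]. Truncating at [r.+1] is harmless, since neighbours of [A]
    have truncated distance at least [r]. *)
Let gam u : C := 2 * theta ^+ tdist B r.+1 u.

Lemma qform_ratio_decay :
  `|qform T' O / qform T' 1%:M - qform T O / qform T 1%:M|
    <= 2 * (#|A| * max_degree G)%:R * theta ^+ r.
Proof.
have AB : [disjoint A & B].
  rewrite -setI_eq0; apply/eqP/setP => v; rewrite !inE.
  apply/negP => /andP[vA vB]; suff : (r < 0)%N by [].
  by apply: dAB vB vA _; exists [::].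
have TB v : v \in B -> T' v = T v by move=> vB; apply: TT'; rewrite (disjointFl AB vB).
have cT Q : is_local B s0 Q -> qform T Q = correlator B s0 T (fun v => (T v)^t* *m T v) Q.
  exact: correlator_expect.
(* The tensors on [B] are unperturbed, so both states give correlators with the same tensors
   there. *)
have cT' Q : is_local B s0 Q -> qform T' Q = correlator B s0 T (fun v => (T' v)^t* *m T' v) Q.
  move=> hQ; rewrite /qform (correlator_expect T' hQ) /correlator; do 2! [apply: eq_bigr => ? _].
  congr (_ * _); apply: eq_netval => v; rewrite /site_ops.
  by case: ifP => // /TB ->.
have l1 := is_local1 B s0.
have g0 u : 0 <= gam u by rewrite mulr_ge0 // exprn_ge0 // ltW.
have gB u : u \in B -> 2 <= gam u by move=> uB; rewrite /gam tdist_in // expr0 mulr1.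
have gadj u v : adj u v -> theta * gam u <= gam v.
  move=> uv; rewrite /gam mulrCA -exprS; apply: ler_wpM2l => //.
  by apply: ler_wiXn2l; rewrite ?tdist_adj // ltW.
have gstep v w : adj v w ->
    2 * eps * \sum_(u | adj v u && (u != w)) gam u <= gam v.
  (* After multiplication by [theta], each summand is at most [gam v], and their number is absorbed
     by [eps_theta]. *)
  move=> vw; rewrite -(ler_pM2l theta_gt0) mulrCA mulr_sumr.
  apply: (@le_trans _ _ (2 * eps * (gam v *+ (max_degree G).-1))).
    apply: ler_wpM2l; first by rewrite mulr_ge0 // ltW.
    apply: (@le_trans _ _ (\sum_(u | adj v u && (u != w)) gam v)).
      by apply: ler_sum => u /andP[vu _]; apply: gadj; rewrite adj_sym.
    by rewrite sumr_const; apply: ler_wpMn2l => //; apply: card_nbrD1.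
  rewrite -[gam v *+ _]mulr_natl mulrA; exact: ler_wpM2r.
have := correlator_decay (E := fun v => (T v)^t* *m T v) (X := fun v => (T v)^t* *m T v)
  (X' := fun v => (T' v)^t* *m T' v) s0 T d0 O_contr eps_le1 g0 gB gstep
  (erefl #|~: (A :|: B)|) AB.
have dU : [disjoint A & ~: (A :|: B)].
  by rewrite disjoints_subset setCK subsetUl.
have dU' : [disjoint ~: (A :|: B) & B].
  by rewrite disjoint_sym disjoints_subset setCK subsetUr.
move=> /(_ dU dU'); rewrite -!cT -?cT' //.
have h1 v : v \notin A -> v \notin B -> (T v)^t* *m T v = (T' v)^t* *m T' v.
  by move=> vA _; rewrite TT'.
have h2 v : v \notin A -> v \notin ~: (A :|: B) -> v \notin B ->
    (T v)^t* *m T v = 1%:M.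
  by move=> /negPf vA; rewrite !inE vA /= negbK => ->.
move=> /(_ h1 (fun _ _ => erefl) h2 (fun v _ => @T_ge v) (fun v _ => @T_le v)
  (fun v _ => @psd_gram _ _ _ _) (fun v _ => @psd_gram _ _ _ _)) h.
have e : qform T' O / qform T' 1%:M - qform T O / qform T 1%:M =
  - (qform T O * qform T' 1%:M - qform T' O * qform T 1%:M) /
    (qform T 1%:M * qform T' 1%:M).
  by field; rewrite !gt_eqF.
have NN : 0 < qform T 1%:M * qform T' 1%:M by exact: mulr_gt0.
rewrite e normrM normrN normfV (gtr0_norm NN) ler_pdivrMr //.
apply: le_trans h _; apply: ler_wpM2r; first exact: ltW.
(* The initial boundary is overcounted by all pairs of a vertex of [A] and a neighbour. *)
apply: (@le_trans _ _ (\sum_(w in A) \sum_(u | adj w u) gam u)).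
  rewrite (exchange_big_dep predT) //= /boundary big_mkcond /=.
  apply: ler_sum => u _; case: ifP => [/andP[_ /exists_inP[w wA wu]]|_].
    by rewrite (bigD1 w) ?wA //= lerDl sumr_ge0.
  by apply: sumr_ge0.
apply: (@le_trans _ _ (\sum_(w in A) (2 * theta ^+ r) *+ max_degree G)).
  apply: ler_sum => w wA.
  apply: (@le_trans _ _ (\sum_(u | adj w u) (2 * theta ^+ r))).
    apply: ler_sum => u wu; apply: ler_wpM2l => //.
    apply: ler_wiXn2l => //; first exact: ltW.
    by apply: (@tdist_ge _ _ r.+1 u w _ wu) => x j xB; apply: dAB xB wA.
  rewrite sumr_const; apply: ler_wpMn2l; last exact: card_nbr.
  by rewrite mulr_ge0 // exprn_ge0 // ltW.
by rewrite sumr_const -mulrnA [leRHS]mulrAC [leRHS]mulr_natr mulnC.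
Qed.

End Perturbation.
End Expectation.

(** * Decay of the messages *)

Lemma card_leg (G : sgraph) (v : G) : (#|{: leg v}| <= max_degree G)%N.
Proof. by rewrite card_sig; apply: card_nbr. Qed.

Lemma trace_diff_le (C : numClosedFieldType) D (H : 'M[C]_D) (b c : C) : b <= c ->
  trace_diff H b -> trace_diff H c.
Proof.
by move=> bc [P [N [hP hN e tP tN]]]; exists P, N; split=> //; apply: le_trans bc.
Qed.

Section Messages.
Variables (C : numClosedFieldType) (G : sgraph) (D : nat).
Variables (E E' : forall v : G, 'M[C]_#|vcfg D v|).
Variables (mu mu' : forall v : G, leg v -> 'M[C]_D).
Variables (A : {set G}) (eps theta : C).
Hypotheses (D_gt0 : (0 < D)%N) (eps_ge0 : 0 <= eps) (eps_lt1 : eps < 1).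
Hypothesis theta_ge0 : 0 <= theta.
Hypothesis eps_theta : 2 * eps / (1 - eps) * (max_degree G).-1%:R <= theta.
Hypothesis E_ge : forall v, psdmx (E v - (1 - eps)%:M).
Hypothesis E_le : forall v, psdmx (1%:M - E v).
Hypothesis EE' : forall v, v \notin A -> E' v = E v.

Definition message_update (F : forall v : G, 'M[C]_#|vcfg D v|)
    (nu : forall v : G, leg v -> 'M[C]_D) (v : G) (n : leg v) : 'M[C]_D :=
  phi n (F v) (fun m : leg v => nu (val m) (rev_leg m)).

Hypothesis mu_fam : forall v (n : leg v), psdmx (mu n) /\ \tr (mu n) = 1.
Hypothesis mu'_fam : forall v (n : leg v), psdmx (mu' n) /\ \tr (mu' n) = 1.
Hypothesis mu_fix : forall v (n : leg v),
  mu n = (\tr (message_update E mu n))^-1 *: message_update E mu n.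
Hypothesis mu'_fix : forall v (n : leg v),
  mu' n = (\tr (message_update E' mu' n))^-1 *: message_update E' mu' n.

(** One use of the fixed-point equation per unit of distance: off [A] both updates use the same [E],
    and a message into [v] starts at a neighbour, at most one step closer to [A]. *)
Lemma message_decay r v (n : leg v) :
  (forall w k, w \in A -> walk v w k -> (r <= k)%N) ->
  trace_diff (mu' n - mu n) (theta ^+ r).
Proof.
elim: r v n => [|r IH] v n far.
  (* Without any distance, the two messages themselves are the positive and negative parts, of trace
     one. *)
  exists (mu' n), (mu n); have [? t] := mu_fam n; have [? t'] := mu'_fam n.
  by split; rewrite // expr0 ?t ?t'.
have vA : v \notin A.
  by apply/negP => /(far v 0%N)/(_ (ex_intro _ [::] (And3 isT erefl erefl))).
rewrite mu_fix mu'_fix /message_update EE' //.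
have := @normalized_phi_diff C _ D n (E v) eps D_gt0 eps_ge0 eps_lt1 (@E_ge v) (@E_le v)
  (fun m : leg v => mu (rev_leg m)) (fun m : leg v => mu' (rev_leg m)) (theta ^+ r)
  (fun m _ => proj1 (mu_fam _)) (fun m _ => proj2 (mu_fam _))
  (fun m _ => proj1 (mu'_fam _)) (fun m _ => proj2 (mu'_fam _)).
have hm (m : leg v) : m != n ->
    trace_diff (mu' (rev_leg m) - mu (rev_leg m)) (theta ^+ r).
  move=> _; apply: IH => w k wA [s [ps ls sk]]; rewrite -ltnS.
  by apply: (far w k.+1 wA); exists (val m :: s); split; rewrite /= ?(valP m) ?sk.
move=> /(_ hm); apply: trace_diff_le; rewrite exprS.
apply: ler_wpM2r; first exact: exprn_ge0.
apply: le_trans eps_theta; apply: ler_wpM2l.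
  by rewrite !mulr_ge0 // invr_ge0 subr_ge0 ltW.
by rewrite ler_nat -!subn1 leq_sub2r ?card_leg.
Qed.

End Messages.

(** * Singular values *)

Section GramBounds.
Variable C : numClosedFieldType.

(** Without rows the Gram matrix is zero and cannot dominate [c]; this gives every site a physical
    basis state. *)
Lemma gram_rows m n (A : 'M[C]_(m, n)) c (j : 'I_n) : 0 < c ->
  psdmx (A^t* *m A - c%:M) -> (0 < m)%N.
Proof.
case: m A => // A c0 /(psd_diag j).
by rewrite !mxE big_ord0 sub0r eqxx oppr_ge0 mulr1n (lt_geF c0).
Qed.

(** Parallelogram law: for S = A - A', the Gram matrices of A' + S and A' - S average to the sum of
    those of A' and S. *)
Lemma gram_perturb m n (A A' : 'M[C]_(m, n)) a b :
  psdmx (A^t* *m A - a%:M) -> psdmx (b%:M - (A - A')^t* *m (A - A')) ->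
  psdmx (A'^t* *m A' - (2^-1 * a - b)%:M).
Proof.
move=> h1 h2; have eA : A = A' + (A - A') by rewrite addrC subrK.
move: (A - A') eA h2 => S eA h2; subst A.
have -> : A'^t* *m A' - (2^-1 * a - b)%:M =
  2^-1 *: ((A' + S)^t* *m (A' + S) - a%:M) +
   (2^-1 *: ((A' - S)^t* *m (A' - S)) + (b%:M - S^t* *m S)).
  rewrite !adjmxD adjmxN !(mulmxDl, mulmxDr) !(mulNmx, mulmxN) opprK.
  move: (A'^t* *m A') (S^t* *m S) (A'^t* *m S) (S^t* *m A') => X Y Z W.
  by apply/matrixP => i j; rewrite !mxE; case: (i == j); rewrite !(mulr1n, mulr0n);
     field.
have h : 0 <= 2^-1 :> C by rewrite invr_ge0.
by apply: psdD; [apply: psdZ|apply: psdD => //; apply: psdZ => //; apply: psd_gram].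
Qed.

Lemma qformE (G : sgraph) D (p : G -> nat) (T : forall v : G, 'M[C]_(p v, #|vcfg D v|))
    (O : 'M[C]_#|pcfg p|) :
  let x := \col_(i < #|pcfg p|) amp T (enum_val i) in
  (x^t* *m O *m x) 0 0 = qform T O.
Proof.
move=> x; rewrite psd_sesq /qform.
rewrite -(sum_enum_val (I := pcfg p)); apply: eq_bigr => i _.
rewrite -(sum_enum_val (I := pcfg p)); apply: eq_bigr => j _.
by rewrite !enum_valK !mxE.
Qed.

End GramBounds.

Local Open Scope complex_scope.

Section SingularValues.
Variable R : realType.

Lemma singval_ge0 m n (A : 'M[R[i]]_(m, n)) j : 0 <= singval A j.
Proof. exact: sqrtr_ge0. Qed.

Lemma spectral_diag_gram m n (A : 'M[R[i]]_(m, n)) j :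
  spectral_diag (A^t* *m A) 0 j = ((singval A j) ^+ 2)%:C.
Proof.
have [_ /(_ j)] := psd_spectral (psd_gram A).
rewrite /singval; case: (spectral_diag _ 0 j) => x y.
by rewrite lecE /= => /andP[/eqP-> x0]; rewrite sqr_sqrtr.
Qed.

Lemma gram_ge m n (A : 'M[R[i]]_(m, n)) d : 0 <= d ->
  (forall j, d <= singval A j) -> psdmx (A^t* *m A - (d ^+ 2)%:C%:M).
Proof.
move=> d0 h; apply: psd_sub_scalar => [|j]; first exact: psd_gram.
by rewrite spectral_diag_gram lecR ler_pXn2r ?nnegrE ?singval_ge0.
Qed.

Lemma gram_le m n (A : 'M[R[i]]_(m, n)) s :
  (forall j, singval A j <= s) -> psdmx ((s ^+ 2)%:C%:M - A^t* *m A).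
Proof.
move=> h; apply: psd_scalar_sub => [|j]; first exact: psd_gram.
have s0 := le_trans (singval_ge0 A j) (h j).
by rewrite spectral_diag_gram lecR ler_pXn2r ?nnegrE ?singval_ge0.
Qed.

Lemma singval_le_opnorm m n (A : 'M[R[i]]_(m, n)) j : singval A j <= opnorm A.
Proof. by rewrite /opnorm; apply: le_bigmax. Qed.

Lemma trnorm_le n (A : 'M[R[i]]_n) b : trace_diff A b%:C -> trnorm A <= 2 * b.
Proof.
move=> [P [N [hP hN e tP tN]]]; rewrite -lecR.
have -> : (trnorm A)%:C = \sum_j sqrtC (spectral_diag (A^t* *m A) 0 j).
  rewrite rmorph_sum; apply: eq_bigr => j _.
  by rewrite spectral_diag_gram rmorphXn /= sqrCK // lecR singval_ge0.
apply: le_trans (sum_sqrt_gram_le hP hN e) _.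
by rewrite mulr_natl mulr2n rmorphD /=; apply: lerD.
Qed.

End SingularValues.

Lemma psd_sub_weaken (C : numClosedFieldType) n (X : 'M[C]_n) a b : b <= a ->
  psdmx (X - a%:M) -> psdmx (X - b%:M).
Proof.
move=> ba hX; have -> : X - b%:M = (X - a%:M) + (a - b) *: 1%:M.
  by rewrite scalemx1 raddfB addrA subrK.
by apply: psdD => //; apply: psdZ; [rewrite subr_ge0|apply: psd1].
Qed.

(** * Translation of the PEPS notions into quadratic forms and message updates *)

Section Bridge.
Variables (R : realType) (G : sgraph) (D : nat) (p : G -> nat).
Implicit Types (T : tensors R D p) (B : {set G}) (O : 'M[R[i]]_#|pcfg p|).

Lemma PhiE T (mu : messages R G D) v (n : leg v) :
  Phi T n (fun m : leg v => mu (val m) (rev_leg m)) =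
  message_update (fun v => (T v)^t* *m T v) mu n.
Proof.
apply/matrixP => i j; rewrite /message_update !mxE /Etr -mulmxA mxtrace_mulC.
by rewrite -[RHS]mxtrace_mulC mulmxA.
Qed.

Lemma expectE T O : expect T O = qform T O / qform T 1%:M.
Proof. by rewrite -!qformE mulmx1. Qed.

Lemma supported_on_is_local B (s0 : pcfg p) O : supported_on B O -> is_local B s0 O.
Proof.
move=> [OB hO] s t; rewrite !hO /agree_off; case: ifPn => // _.
rewrite ifT.
  by congr (OB _ _); apply/ffunP => v; rewrite !ffunE (valP v).
apply/forallP => v; apply/implyP => /negPf vB.
by rewrite !ffunE vB.
Qed.

Lemma opnorm_contraction O : opnorm O <= 1 -> contraction O.
Proof.
move=> h; have := @gram_le _ _ _ O 1
  (fun j => le_trans (singval_le_opnorm O j) h).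
by rewrite expr1n rmorph1; apply: contraction_gram.
Qed.

End Bridge.

(** * Constants, and both decay estimates for the perturbed PEPS *)

Theorem theorem3 (R : realType) (eps_ss : nat -> nat -> R)
  (eps_ss_O : exists M : R, forall D Delta : nat, (0 < D)%N -> (0 < Delta)%N ->
     eps_ss D Delta <=
       M * Num.min (D%:R^-1) ((D%:R / Delta%:R) `^ (Delta%:R / 2)))
  (eps_ss_lt : forall D Delta : nat, (0 < D)%N -> (0 < Delta)%N ->
     eps_ss D Delta < eps_star R Delta)
  (D Delta : nat) (D_gt0 : (0 < D)%N) (Delta_gt0 : (0 < Delta)%N) :
  exists kappa k1 k2 : R, [/\ 0 < kappa, 0 < k1, 0 < k2 &
  forall eps : R, 0 < eps -> eps < eps_ss D Delta ->
  exists xi_s : R,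
    k1 * ln (eps_star R Delta / eps) <= xi_s^-1
      <= k2 * ln (eps_star R Delta / eps) /\
  forall a b : nat, exists K : R,
  forall c : R, c0 R Delta < c ->
    loop_decay_threshold D Delta (eps_ss D Delta) c ->
  exists xi_ss : R,
    k1 * Num.min xi_s^-1 (c - c0 R Delta) <= xi_ss^-1
      <= k2 * Num.min xi_s^-1 (c - c0 R Delta) /\
  forall (G : sgraph) (p : G -> nat) (T T' : tensors R D p) (A : {set G})
    (mu mu' : messages R G D),
    max_degree G = Delta ->
    normalized T -> injectivity T eps ->
    #|A| = a ->
    (forall v, v \notin A -> T' v = T v) ->
    (forall v, v \in A ->
       opnorm (T v - T' v) <= kappa * (eps_star R Delta - eps)) ->
    bp_fixed_point T mu -> bp_fixed_point T' mu' ->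
    (forall (v : G) (n : leg v) (r : nat), at_distance [set v] A r ->
       trnorm (mu' v n - mu v n) <= K * expR (- (r%:R / xi_s))) /\
    (forall (B : {set G}) (O : 'M[R[i]]_#|pcfg p|) (r : nat),
       #|B| = b -> at_distance B A r ->
       supported_on B O -> O \is hermsymmx -> opnorm O = 1 ->
       `|expect T' O - expect T O| <= (K * expR (- (r%:R / xi_ss)))%:C)].
Proof.
(* [k1 = k2 = 1] because both inverse lengths are matched exactly; [kappa = 2^-1] keeps the
   perturbed tensors injective. *)
exists 2^-1, 1, 1; split; rewrite ?invr_gt0 ?ltr01 ?ltr0n // => eps eps_gt0 eps_lt.
have {}eps_lt := lt_trans eps_lt (eps_ss_lt D Delta D_gt0 Delta_gt0).
set es := eps_star R Delta in eps_lt *.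
set h : R := 2 * Delta%:R - 1.
have Delta_ge1 : 1 <= Delta%:R :> R by rewrite ler1n.
have h_ge1 : 1 <= h by rewrite /h; lra.
have h_gt0 : 0 < h by lra.
have es_gt0 : 0 < es by rewrite invr_gt0.
have es_le1 : es <= 1 by rewrite invf_le1.
(* This is [eps / eps_star], the decay factor per step; its powers are exactly the exponentials with
   length [xi_s]. *)
pose theta := eps * h.
have theta_gt0 : 0 < theta by rewrite mulr_gt0.
have theta_lt1 : theta < 1 by rewrite -ltr_pdivlMr // div1r.
have ln_eq : ln (es / eps) = - ln theta.
  by rewrite -lnV ?posrE // /theta invfM mulrC.
have ln_gt0 : 0 < - ln theta by rewrite oppr_gt0 ln_lt0 // theta_gt0.
have pow_theta r (x : R) : x <= - ln theta -> theta ^+ r <= expR (- (r%:R * x)).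
  move=> hx; rewrite -[theta in leLHS]lnK ?posrE // -expRM_natl ler_expR.
  by rewrite -mulrN ler_wpM2l // lerNr.
exists (ln (es / eps))^-1; split; first by rewrite invrK !mul1r lexx.
(* The 2 covers the trace norm of the messages and the case of distance zero; the division by
   [theta] makes up for the step lost between [A] and its neighbours. *)
move=> a b; exists (2 + 2 * (a * Delta)%:R / theta) => c hc _.
rewrite invrK ln_eq.
set m := Num.min _ _; have m_le : m <= - ln theta by rewrite ge_min lexx.
(* The minimum is at most [- ln theta], so powers of [theta] decay at least this fast. *)
exists m^-1; split; first by rewrite invrK !mul1r lexx.
move=> G p T T' A mu mu' degG Tnorm [d [d0 ed hd]] cA TT' dT [mu_fam mu_fix] [mu'_fam mu'_fix].
have eps_lt1 : eps < 1 by apply: lt_le_trans es_le1.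
have d2 : d ^+ 2 = 1 - eps by rewrite ed opprB addrC subrK.
have d2_gt0 : 0 < d ^+ 2 by rewrite d2 subr_gt0.
have d_le1 : d ^+ 2 <= 1 by rewrite d2 gerBl ltW.
have eC1 : (d ^+ 2)%:C = 1 - eps%:C by rewrite d2 rmorphB rmorph1.
have epsC_gt0 : 0 < eps%:C by rewrite ltcR.
have epsC_lt1 : eps%:C < 1 by rewrite -(rmorph1 (real_complex R)) ltcR.
have thC_gt0 : 0 < theta%:C by rewrite ltcR.
have E_ge v : psdmx ((T v)^t* *m T v - (1 - eps%:C)%:M).
  by rewrite -eC1; apply: gram_ge => // j; have /andP[] := hd v j.
have E_le v : psdmx (1%:M - (T v)^t* *m T v).
  have := @gram_le _ _ _ (T v) 1 (fun j => proj2 (andP (hd v j))).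
  by rewrite expr1n rmorph1.
have D1 : (Delta.-1)%:R = Delta%:R - 1 :> R by rewrite -subn1 natrB.
have step1 : 2 * eps * (Delta.-1)%:R <= theta.
  by rewrite D1 /theta /h mulrAC mulrC; apply: ler_wpM2l; [exact: ltW|lra].
(* Since [h - 1] is twice [Delta - 1], this amounts to [eps * h <= 1], that is, to
   [eps <= eps_star]. *)
have step2 : 2 * eps / (1 - eps) * (Delta.-1)%:R <= theta.
  rewrite mulrAC ler_pdivrMr ?subr_gt0 // D1 /theta -mulrA mulrAC mulrC -mulrA.
  have : eps * h < 1 by exact: theta_lt1.
  rewrite /h => ?; nra.
split.
  move=> v n r [_ far].
  have := @message_decay _ G D (fun v => (T v)^t* *m T v) (fun v => (T' v)^t* *m T' v)
    mu mu' A eps%:C theta%:C D_gt0 (ltW epsC_gt0) epsC_lt1 (ltW thC_gt0).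
  have st : 2 * eps%:C / (1 - eps%:C) * (max_degree G).-1%:R <= theta%:C.
    rewrite degG; move: step2; rewrite -lecR.
    by rewrite !(rmorphM, rmorphB, fmorphV, rmorph_nat, rmorph1).
  move=> /(_ st E_ge E_le).
  have EE v' : v' \notin A -> (T' v')^t* *m T' v' = (T v')^t* *m T v'.
    by move=> vA; rewrite TT'.
  move=> /(_ EE (fun v n => mu_fam v n) (fun v n => mu'_fam v n)).
  have gx v' (n' : leg v') : mu v' n' =
     (\tr (message_update (fun v => (T v)^t* *m T v) mu n'))^-1 *:
       message_update (fun v => (T v)^t* *m T v) mu n'.
    by rewrite -PhiE; apply: mu_fix.
  have gx' v' (n' : leg v') : mu' v' n' =
     (\tr (message_update (fun v => (T' v)^t* *m T' v) mu' n'))^-1 *: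
       message_update (fun v => (T' v)^t* *m T' v) mu' n'.
    by rewrite -PhiE; apply: mu'_fix.
  move=> /(_ gx gx' r v n (fun w k => far v w k (set11 v))).
  rewrite -rmorphXn => /trnorm_le hn; apply: le_trans hn _.
  apply: ler_pM => //; first by apply: exprn_ge0; apply: ltW.
    by rewrite lerDl divr_ge0 ?mulr_ge0 // ltW.
  by apply: pow_theta.
move=> B O r cB [[x [w [xB wA xw]]] far] supO _ nO.
have O_contr : contraction O by apply: opnorm_contraction; rewrite nO.
pose i0 : 'I_D := Ordinal D_gt0.
have p_gt0 v : (0 < p v)%N.
  by apply: gram_rows (enum_rank [ffun=> i0]) _ (E_ge v); rewrite subr_gt0.
pose s0 : pcfg p := [ffun v => Ordinal (p_gt0 v)].
have q_gt0 : 0 < (d ^+ 2 / 4)%:C by rewrite ltcR divr_gt0.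
(* On [A] the perturbation is at most [k <= d ^+ 2 / 2], so [d ^+ 2 / 2 - k ^+ 2] is at least
   [d ^+ 2 / 4], as [d ^+ 2 <= 1]. *)
have E'_ge v : psdmx ((T' v)^t* *m T' v - (d ^+ 2 / 4)%:C%:M).
  have [vA|vA] := boolP (v \in A); last first.
    rewrite TT' //; apply: psd_sub_weaken (E_ge v).
    by rewrite -eC1 lecR; lra.
  set k := 2^-1 * (es - eps) in dT.
  have hk := @gram_le _ _ _ (T v - T' v) k
    (fun j => le_trans (singval_le_opnorm _ j) (dT v vA)).
  apply: psd_sub_weaken (gram_perturb (E_ge v) hk).
  have -> : 2^-1 * (1 - eps%:C) - (k ^+ 2)%:C = (2^-1 * d ^+ 2 - k ^+ 2)%:C.
    rewrite -eC1 [RHS]rmorphB; congr (_ - _).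
    by rewrite [RHS]rmorphM [X in _ = X * _]fmorphV [X in _ = X^-1 * _]rmorph_nat.
  rewrite lecR.
  have half0 : 0 <= 2^-1 :> R by rewrite invr_ge0.
  have k0 : 0 <= k by apply: mulr_ge0 => //; rewrite subr_ge0 ltW.
  have kd : k <= 2^-1 * d ^+ 2 by rewrite d2; apply: ler_wpM2l => //; apply: lerB.
  have : k ^+ 2 <= (2^-1 * d ^+ 2) ^+ 2 by rewrite ler_pXn2r ?nnegrE // (le_trans k0).
  have : d ^+ 2 * d ^+ 2 <= d ^+ 2 by rewrite ger_pMl.
  by rewrite exprMn; move: (d ^+ 2) (k ^+ 2) => y z ? ?; lra.
have N_gt0 : 0 < qform T 1%:M.
  by apply: (qform1_gt0 i0 _ E_ge); rewrite subr_gt0.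
have N'_gt0 : 0 < qform T' 1%:M by exact: (qform1_gt0 i0 q_gt0 E'_ge).
have th_ge0 r' : 0 <= theta ^+ r' by rewrite exprn_ge0 // ltW.
have K2 : 0 <= 2 * (a * Delta)%:R / theta by rewrite divr_ge0 ?mulr_ge0 // ltW.
have K0 : 0 <= 2 + 2 * (a * Delta)%:R / theta by apply: addr_ge0.
have fin r' : theta ^+ r' <= expR (- (r'%:R / m^-1)).
  by rewrite invrK; apply: pow_theta.
rewrite !expectE.
(* At distance zero it suffices that both expectation values have modulus at most one. *)
case: r far xw => [|r] far xw.
  have le1 (S : tensors R D p) : 0 < qform S 1%:M ->
      `|qform S O / qform S 1%:M| <= 1.
    move=> S0; rewrite normrM normfV (gtr0_norm S0) ler_pdivrMr // mul1r.
    exact: qform_le.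
  apply: le_trans (ler_normB _ _) _.
  apply: le_trans (lerD (le1 _ N'_gt0) (le1 _ N_gt0)) _.
  rewrite -(rmorph1 (real_complex R)) -rmorphD lecR.
  apply: le_trans (ler_wpM2l K0 (fin 0%N)).
  by rewrite expr0 mulr1 lerDl.
have far' y w' j : y \in B -> w' \in A -> walk y w' j -> (r < j)%N.
  by move=> yB w'A; apply: far.
have st : 2 * eps%:C * (max_degree G).-1%:R <= theta%:C.
  rewrite degG; move: step1; rewrite -lecR.
  by rewrite !(rmorphM, rmorph_nat).
have thC_le1 : theta%:C <= 1 by rewrite -(rmorph1 (real_complex R)) lecR ltW.
have := @qform_ratio_decay _ G D p T T' A B O s0 i0 eps%:C theta%:C r
  epsC_gt0 thC_le1 st thC_gt0 (ltW epsC_lt1) E_ge E_le TT' O_contr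
  (supported_on_is_local s0 supO) far' N_gt0 N'_gt0.
move=> hq; apply: le_trans hq _.
have -> : 2 * (#|A| * max_degree G)%:R * theta%:C ^+ r =
    (2 * (a * Delta)%:R * theta ^+ r)%:C.
  by rewrite cA degG !(rmorphM, rmorphXn, rmorph_nat).
rewrite lecR.
apply: le_trans (ler_wpM2l K0 (fin r.+1)).
rewrite exprS [leRHS]mulrDl [X in _ <= _ + X]mulrA divfK ?gt_eqF //.
by rewrite lerDr mulr_ge0 // mulr_ge0 // ltW.
Qed.
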